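(* Let $K$ be a number field, $\mathcal{T}\subset\mathcal{O}_K\setminus\{0\}$ a finite set, $\mathcal{C}$ an ideal class of $\mathcal{O}_K$ and $0<\delta<1$. Suppose that property $(\star)$ holds for the triple $(\mathcal{C},\mathcal{T},\delta)$. Then, for all but finitely many prime ideals $\mathfrak{P}$ of $\mathcal{O}_K$ belonging to the class $\mathcal{C}$, the field $K$ satisfies the $(\mathfrak{P},\mathcal{T})$-adic CFF property.
   Context: Let $K$ have signature $(r_1,r_2)$ and degree $d$, with real embeddings $\sigma_1,\ldots,\sigma_{r_1}$ and representatives $\tau_1,\ldots,\tau_{r_2}$ of the pairs of complex conjugate embeddings. Let $\iota:K\to\mathbb{R}^{r_1}\times\mathbb{C}^{r_2}$, $\iota(x)=(\sigma_1(x),\ldots,\sigma_{r_1}(x),\tau_1(x),\ldots,\tau_{r_2}(x))$, and $N:\mathbb{R}^{r_1}\times\mathbb{C}^{r_2}\to\mathbb{R}$, $N(x_1,\ldots,x_{r_1},z_1,\ldots,z_{r_2})=x_1\cdots x_{r_1}z_1\bar z_1\cdots z_{r_2}\bar z_{r_2}$. For an ideal $\mathfrak{I}$, $\mathcal{N}(\mathfrak{I})=|\mathcal{O}_K/\mathfrak{I}|$. For a nonzero integral ideal $\mathfrak{A}$, a finite $\mathcal{T}\subseteq\mathcal{O}_K\setminus\{0\}$ and $0<\delta<1$, property $(\star)$ holds for $(\mathfrak{A},\mathcal{T},\delta)$ if for every $\xi\in\mathbb{R}^{r_1}\times\mathbb{C}^{r_2}$ there exist $\omega\in\iota(\mathfrak{A})$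 and $x\in\iota(\mathcal{T})$ with $|N(x\xi-\omega)|<\delta\,\mathcal{N}(\mathfrak{A})$. This holds for one integral ideal of a class $\mathcal{C}$ iff it holds for all of them, and then property $(\star)$ is said to hold for $(\mathcal{C},\mathcal{T},\delta)$. Absolute values: for a place $w$ over $v\in\mathcal{M}_\mathbb{Q}$, $|x|_w=|N_{K_w/\mathbb{Q}_v}(x)|_v^{1/[K_w:\mathbb{Q}_v]}$ with standard normalizations. $\mathcal{O}_{\{\mathfrak{P}\}}=\{\alpha\in K: v_\mathfrak{Q}(\alpha)\ge0 \ \forall \text{ primes }\mathfrak{Q}\ne\mathfrak{P}\}$. A $\mathfrak{P}$-adic $\mathcal{T}$-floor function for $K$ is $s:K_\mathfrak{P}\to K$ with (i) $\alpha-s(\alpha)\in\mathfrak{P}\mathcal{O}_\mathfrak{P}$ for all $\alpha$; (ii) for every $\alpha$ there is $t\in\mathcal{T}$ with $t\,s(\alpha)\in\mathcal{O}_{\{\mathfrak{P}\}}$; (iii) $s(0)=0$; (iv) $\alpha-\beta\in\mathfrak{P}\mathcal{O}_\mathfrak{P}\Rightarrow s(\alpha)=s(\beta)$. The continued fraction expansion of $\alpha\in K_\mathfrak{P}$ of type $(K,\mathfrak{P},\mathcal{T},s)$ is $[a_0,a_1,\ldots]$ with $\alpha_0=\alpha$, $a_n=s(\alpha_n)$, $\alpha_{n+1}=1/(\alpha_n-a_n)$ if $\alpha_n\ne a_n$, stopping when $\alpha_n=a_n$. $K$ satisfies the $(\mathfrak{P},\mathcal{T})$-adic CFF property if there is a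 $\mathfrak{P}$-adic $\mathcal{T}$-floor function $s$ such that every $\alpha\in K$ has a finite expansion of type $(K,\mathfrak{P},\mathcal{T},s)$. *)

(* Defs.v *)
From HB Require Import structures.
From mathcomp Require Import all_boot all_order all_algebra all_field.
From mathcomp Require Import finmap.
From mathcomp Require Import boolp classical_sets functions cardinality.
From mathcomp Require Import reals constructive_ereal.
From mathcomp Require Import complex.

Set Implicit Arguments.
Unset Strict Implicit.
Unset Printing Implicit Defensive.

Import Order.TTheory GRing.Theory Num.Theory.

Local Open Scope classical_set_scope.
Local Open Scope ring_scope.

(** A number field is a finite extension [K : fieldExtType rat].  Its ring of
    integers, ideals and fractional ideals are subsets of [K]. *)

Section Ideals.
Variable K : fieldExtType rat.
Implicit Types (I J A P Q : set K) (x : K).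

Definition ring_of_integers : set K :=
  [set x | integralOver (intr : int -> K) x].

Record is_submodule I : Prop := IsSubmodule {
  submodule0 : I 0;
  submoduleD : forall x y, I x -> I y -> I (x + y);
  submoduleM : forall a x, ring_of_integers a -> I x -> I (a * x) }.

Definition is_ideal I : Prop := I `<=` ring_of_integers /\ is_submodule I.

Definition is_nonzero I : Prop := exists2 x, I x & x != 0.

Definition is_fractional_ideal I : Prop :=
  [/\ is_submodule I, is_nonzero I &
      exists d, [/\ ring_of_integers d, d != 0 &
                    forall x, I x -> ring_of_integers (d * x)]].

Definition is_prime_ideal P : Prop :=
  [/\ is_ideal P, is_nonzero P, ~ P 1 &
      forall a b, ring_of_integers a -> ring_of_integers b ->
        P (a * b) -> P a \/ P b].

Definition ideal_class I : set (set K) :=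
  [set J | exists2 a : K, a != 0 & J = [set a * x | x in I]].

Definition is_ideal_class (C : set (set K)) : Prop :=
  exists2 I, is_fractional_ideal I & C = ideal_class I.

(** The cosets of [A] in the ring of integers, and their number. *)
Definition quotient_by A : set (set K) :=
  [set [set y | A (y - x)] | x in ring_of_integers].

Definition ideal_norm A : nat := #|` fset_set (quotient_by A)|.

Definition ideal_mul I J : set K :=
  [set x | exists n (a b : 'I_n -> K),
     (forall i, I (a i) /\ J (b i)) /\ x = \sum_(i < n) a i * b i].

Definition ideal_exp I n : set K := iter n (ideal_mul I) ring_of_integers.

(** [integral_ord Q a n]: the exact power of [Q] dividing [a] is [Q ^ n]. *)
Definition integral_ord Q (a : K) (n : nat) : Prop :=
  ideal_exp Q n a /\ ~ ideal_exp Q n.+1 a.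

(** [v_Q x = v_Q a - v_Q b] for any writing [x = a / b] with [a], [b] nonzero
    integers of [K]; the value does not depend on it, so [xget] selects from
    a singleton when [Q] is a prime ideal and [x != 0]. *)
Definition valuation Q x : \bar int :=
  if x == 0 then +oo%E else
  (xget (0 : int) [set m | exists (a b : K) (n k : nat),
     [/\ ring_of_integers a /\ integral_ord Q a n,
         ring_of_integers b /\ integral_ord Q b k,
         a != 0 /\ b != 0,
         x = a / b & m = n%:Z - k%:Z]])%:E.

Definition integral_outside P : set K :=
  [set x | forall Q, is_prime_ideal Q -> Q <> P -> (0%:E <= valuation Q x)%E].

End Ideals.

Arguments ring_of_integers K : clear implicits.

(** ** The archimedean embedding and property (star) *)

Section Archimedean.
Variables (R : realType) (K : fieldExtType rat) (r1 r2 : nat).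

Record is_embedding_system (sigma : 'I_r1 -> {rmorphism K -> R})
    (tau : 'I_r2 -> {rmorphism K -> R[i]}) : Prop := IsEmbeddingSystem {
  real_embedding_inj : forall i j, sigma i =1 sigma j -> i = j;
  real_embedding_surj : forall f : {rmorphism K -> R}, exists i, f =1 sigma i;
  complex_embedding_nonreal : forall i, exists x, complex.Im (tau i x) != 0;
  complex_embedding_inj : forall i j,
    tau i =1 tau j \/ (forall x, tau i x = conjc (tau j x)) -> i = j;
  complex_embedding_surj : forall f : {rmorphism K -> R[i]},
    (exists x, complex.Im (f x) != 0) ->
    exists i, f =1 tau i \/ (forall x, f x = conjc (tau i x)) }.

(** R^r1 x C^r2, with its componentwise ring operations. *)
Definition arch_space : pzRingType :=
  ({ffun 'I_r1 -> R} * {ffun 'I_r2 -> R[i]})%type.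

Definition arch_norm (xi : arch_space) : R :=
  (\prod_(i < r1) xi.1 i) *
  \prod_(j < r2) complex.Re (xi.2 j * conjc (xi.2 j)).

Variables (sigma : 'I_r1 -> {rmorphism K -> R})
          (tau : 'I_r2 -> {rmorphism K -> R[i]}).

Definition arch_embed (x : K) : arch_space :=
  ([ffun i => sigma i x], [ffun j => tau j x]).

Definition star_ideal (A T : set K) (delta : R) : Prop :=
  forall xi : arch_space, exists omega x : K,
    [/\ A omega, T x &
        `|arch_norm (arch_embed x * xi - arch_embed omega)|
          < delta * (ideal_norm A)%:R].

(** The property is the same for all integral ideals of the class, so it is
    required for one of them. *)
Definition star_class (C : set (set K)) (T : set K) (delta : R) : Prop :=
  exists A, [/\ C A, is_ideal A & star_ideal A T delta].

End Archimedean.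

(** ** Completions

    A completion of [K] at [P] is a complete valued field containing [K] as a
    dense subfield, with valuation extending that of [P]; it is unique up to a
    unique isomorphism of valued extensions of [K]. *)

Record completion (K : fieldExtType rat) (P : set K) := Completion {
  completion_field :> fieldType;
  completion_embed : {rmorphism K -> completion_field};
  completion_val : completion_field -> \bar int;
  completion_val_eqNy : forall x, completion_val x <> -oo%E;
  completion_val_eqy : forall x, completion_val x = +oo%E <-> x = 0;
  completion_valM : forall x y,
    completion_val (x * y) = (completion_val x + completion_val y)%E;
  completion_valD : forall x y,
    (Order.min (completion_val x) (completion_val y)
       <= completion_val (x + y)%R)%E;
  completion_val_embed : forall a : K,
    completion_val (completion_embed a) = valuation P a;
  completion_dense : forall (x : completion_field) (m : int),
    exists a : K, (m%:E <= completion_val (x - completion_embed a)%R)%E;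
  completion_complete : forall u : nat -> completion_field,
    (forall m : int, exists N, forall i j, (N <= i)%N -> (N <= j)%N ->
       (m%:E <= completion_val (u i - u j)%R)%E) ->
    exists l, forall m : int, exists N, forall i, (N <= i)%N ->
       (m%:E <= completion_val (u i - l)%R)%E }.

Arguments completion_embed {K P} c.
Arguments completion_val {K P} c.

Section FloorFunctions.
Variables (K : fieldExtType rat) (P : set K) (KP : completion P).
Local Notation emb := (completion_embed KP).

Definition local_integers : set KP :=
  [set x | (0%:E <= completion_val KP x)%E].

(** The extension of the ideal [P] to the ring [local_integers]. *)
Definition local_ideal : set KP :=
  [set x | exists n (a : 'I_n -> K) (y : 'I_n -> KP),
     (forall i, P (a i) /\ local_integers (y i)) /\
     x = \sum_(i < n) emb (a i) * y i].

Record is_floor (T : set K) (s : KP -> K) : Prop := IsFloor {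
  floor_approx : forall x, local_ideal (x - emb (s x));
  floor_denominator : forall x,
    exists2 t, T t & integral_outside P (t * s x);
  floor_zero : s 0 = 0;
  floor_coset : forall x y, local_ideal (x - y) -> s x = s y }.

(** [None] means that the expansion has already stopped. *)
Fixpoint complete_quotient (s : KP -> K) (x : KP) (n : nat) : option KP :=
  if n is n'.+1 then
    if complete_quotient s x n' is Some y then
      if y == emb (s y) then None else Some (1 / (y - emb (s y)))
    else None
  else Some x.

Definition partial_quotient (s : KP -> K) (x : KP) (n : nat) : option K :=
  omap s (complete_quotient s x n).

Definition finite_expansion (s : KP -> K) (x : KP) : Prop :=
  exists n, partial_quotient s x n = None.

End FloorFunctions.

Definition CFF_property (K : fieldExtType rat) (P T : set K) : Prop :=
  forall KP : completion P, exists2 s : KP -> K, is_floor T s &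
    forall a : K, finite_expansion s (completion_embed KP a).

(* Main.v *)
Require Import Defs.
From HB Require Import structures.
From mathcomp Require Import all_boot all_order all_algebra all_field all_fingroup.
From mathcomp Require Import boolp classical_sets functions cardinality.
From mathcomp Require Import reals constructive_ereal.
From mathcomp Require Import complex.
From mathcomp Require Import finmap topology normedtype.
From mathcomp Require Import ring lra zify.

(** Let [P] be a prime of the class, [N] its norm and [e] a number strictly
    between [delta] and [1].  Dirichlet's pigeonhole argument gives [p] in [P]
    whose embeddings are all [O(N^(1/d))]; the module [p^-1 P] then lies in a
    finite set independent of [P].  For each module of that set, compactness of
    the torus makes the [omega] of property (star) bounded; scaling back by [p]
    gives, for every [y] in [K], [t] in [T] and [omega] in [P] such that
    [t y - omega] has embeddings [O(N^(1/d))] and norm less than [delta N], so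
    that [prod_k (|t|_k + |t y - omega|_k) <= e N] once [N] is large.

    The floor of a coset is a digit [y - omega / t] obtained in this way from a
    representative [y] integral away from [P].  If the expansion of [a] with
    digits [a_n] of denominators [t_n] did not stop, then
    [beta_(n+1) = beta_n (alpha_n - a_n)], started at an integer clearing the
    denominator of [a], would satisfy [beta_(n+2) = beta_n - a_(n+1) beta_(n+1)].
    So [z_n = t_0 ... t_(n-1) beta_n] is integral away from [P], nonzero, and of
    valuation at least [n] at [P]: its norm is at least [N^n] when [n] is a
    multiple of the order of [P] in the class group.  The bound on the digits
    and the recurrence give a norm [O((e N)^n)], a contradiction. *)

Set Implicit Arguments.
Unset Strict Implicit.
Unset Printing Implicit Defensive.

Import Order.TTheory GRing.Theory Num.Theory.
Import numFieldNormedType.Exports.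

Local Open Scope classical_set_scope.
Local Open Scope ring_scope.

(** * Index of subgroups *)

(** Property (star) bounds only the product of the [|t y - omega|_k], whereas one step of the
    recurrence multiplies the norm by up to [prod_k (|t|_k + |t y - omega|_k)]. If one embedding
    were huge and another tiny, the mixed terms would dominate. Hence [omega] has to be balanced:
    when every embedding is [O(N^(1/d))], each mixed term is [O(N^((d-1)/d))], and the gap between
    [delta] and [e] absorbs it for large [N]. The implied constant must not depend on [P], which
    forces the passage through finitely many modules. The excluded primes are those of small norm
    and those containing an element of [T]: a denominator [t] must be a unit at [P] for [omega / t]
    to stay in the maximal ideal of the completion.

    Factorization of ideals is never invoked. The finite set of modules also makes some power of [P]
    principal, [P^h = (w)]; additivity of the valuation, integrality away from [P] (denominators are
    powers of [w]) and the lower bound on norms are all deduced from this generator. *)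

Section Index.
Variable V : zmodType.
Implicit Types G H L : set V.

Definition subgroup H := H 0 /\ forall x y, H x -> H y -> H (x - y).

Lemma subgroupN H x : subgroup H -> H x -> H (- x).
Proof. by move=> [H0 HB] Hx; rewrite -sub0r; apply: HB. Qed.

Lemma subgroupD H x y : subgroup H -> H x -> H y -> H (x + y).
Proof. by move=> sH Hx Hy; rewrite -[y]opprK; apply: sH.2 => //; apply: subgroupN. Qed.

Lemma subgroup_sub_sym H x y : subgroup H -> H (x - y) -> H (y - x).
Proof. by move=> sH Hxy; rewrite -opprB; apply: subgroupN. Qed.

Lemma subgroup_trans H x y z :
  subgroup H -> H (x - y) -> H (y - z) -> H (x - z).
Proof.
move=> sH Hxy Hyz; rewrite (_ : x - z = (x - y) + (y - z)); last by rewrite addrA subrK.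
exact: subgroupD.
Qed.

Lemma subgroupMn H x n : subgroup H -> H x -> H (x *+ n).
Proof.
move=> sH Hx; elim: n => [|n IH]; first by rewrite mulr0n; case: sH.
by rewrite mulrS; apply: subgroupD.
Qed.

Lemma subgroup_sum H (I : Type) (s : seq I) (P : pred I) (F : I -> V) :
  subgroup H -> (forall i, P i -> H (F i)) -> H (\sum_(i <- s | P i) F i).
Proof.
move=> sH HF; elim/big_ind: _ => // [|x y]; first by case: sH.
exact: subgroupD.
Qed.

Definition transversal_of G H (X : finType) (r : X -> V) :=
  (forall i, G (r i)) /\ (forall i j, H (r i - r j) -> i = j).

(** The lower bound is kept apart from the index itself: pigeonhole arguments only exhibit pairwise
    incongruent elements, and an infinite index needs no convention. *)
Definition index_at_least G H n := exists r : 'I_n -> V, transversal_of G H r.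

Definition has_index G H n := exists2 r : 'I_n -> V, transversal_of G H r &
  forall x, G x -> exists i, H (x - r i).

Lemma index_at_least_fin G H (X : finType) (r : X -> V) :
  transversal_of G H r -> index_at_least G H #|X|.
Proof.
move=> [Gr Hr]; exists (fun i => r (enum_val i)); split=> [i|i j /Hr]; first exact: Gr.
exact: enum_val_inj.
Qed.

Lemma has_index_fin G H (X : finType) (r : X -> V) :
  transversal_of G H r -> (forall x, G x -> exists i, H (x - r i)) ->
  has_index G H #|X|.
Proof.
move=> [Gr Hr] cov; exists (fun i => r (enum_val i)).
  by split=> [i|i j /Hr]; [exact: Gr | exact: enum_val_inj].
by move=> x /cov[i Hi]; exists (enum_rank i); rewrite enum_rankK.
Qed.

Lemma has_index_at_least G H n : has_index G H n -> index_at_least G H n.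
Proof. by move=> [r tr _]; exists r. Qed.

Lemma index_at_least_le G H n m :
  subgroup H -> has_index G H n -> index_at_least G H m -> (m <= n)%N.
Proof.
move=> sH [r _ cov] [s [Gs Hs]].
have /choice[f Hf] : forall i, exists j, H (s i - r j) by move=> i; apply: cov.
have inj_f : injective f.
  move=> i j fij; apply: Hs; apply: (subgroup_trans (y := r (f i)) sH (Hf i)).
  by rewrite fij; apply: subgroup_sub_sym.
by have := leq_card f inj_f; rewrite !card_ord.
Qed.

Lemma has_index_uniq G H n m :
  subgroup H -> has_index G H n -> has_index G H m -> n = m.
Proof.
move=> sH Gn Gm; apply/eqP; rewrite eqn_leq.
by rewrite (index_at_least_le sH Gm (has_index_at_least Gn))
  (index_at_least_le sH Gn (has_index_at_least Gm)).
Qed.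

Lemma index_at_least_mul G H L n m :
  subgroup G -> subgroup H -> H `<=` G -> L `<=` H ->
  index_at_least G H n -> index_at_least H L m -> index_at_least G L (n * m)%N.
Proof.
move=> sG sH HG LH [r [Gr Hr]] [s [Hs Ls]].
have := @index_at_least_fin G L ('I_n * 'I_m)%type (fun p => r p.1 + s p.2).
rewrite card_prod !card_ord; apply; split=> [p|[i j] [i' j'] /= Lp].
  by apply: subgroupD => //; apply/HG.
have ii' : i = i'.
  apply: Hr; rewrite (_ : _ - _ = (r i + s j - (r i' + s j')) - (s j - s j')).
    by apply: sH.2; [exact: LH | exact: sH.2].
  by rewrite opprD addrACA addrK.
rewrite -{}ii' in Lp *; congr (_, _); apply: Ls.
by rewrite opprD addrACA subrr add0r in Lp.
Qed.

Lemma has_index_mul G H L n m :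
  subgroup G -> subgroup H -> subgroup L -> H `<=` G -> L `<=` H ->
  has_index G H n -> has_index H L m -> has_index G L (n * m)%N.
Proof.
move=> sG sH sL HG LH [r [Gr Hr] cr] [s [Hs Ls] cs].
have := @has_index_fin G L ('I_n * 'I_m)%type (fun p => r p.1 + s p.2).
rewrite card_prod !card_ord; apply; last first.
  move=> x /cr[i /cs[j Lj]]; exists (i, j) => /=.
  by rewrite opprD addrA.
split=> [p|[i j] [i' j'] /= Lp].
  by apply: subgroupD => //; apply/HG.
have ii' : i = i'.
  apply: Hr; rewrite (_ : _ - _ = (r i + s j - (r i' + s j')) - (s j - s j')).
    by apply: sH.2; [exact: LH | exact: sH.2].
  by rewrite opprD addrACA addrK.
rewrite -{}ii' in Lp *; congr (_, _); apply: Ls.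
by rewrite opprD addrACA subrr add0r in Lp.
Qed.

(** A transversal of maximal size is exhaustive, since an element of [G] missed by it could be
    added. *)
Lemma has_index_bound G H N : subgroup H -> G 0 ->
  (forall m, index_at_least G H m -> (m <= N)%N) -> exists2 n, has_index G H n & (0 < n)%N.
Proof.
move=> sH G0 bnd.
have ex1 : exists m, `[< index_at_least G H m >].
  exists 1%N; apply/asboolP; exists (fun=> 0); split=> // i j _.
  by rewrite !ord1.
have ubd m : `[< index_at_least G H m >] -> (m <= N)%N by move=> /asboolP/bnd.
case: (ex_maxnP ex1 ubd) => n /asboolP[r [Gr Hr]] nmax; exists n; last first.
  apply: nmax; apply/asboolP; exists (fun=> 0); split=> // i j _.
  by rewrite !ord1.
exists r => // x Gx; apply: contrapT => /forallNP nox.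
suff /nmax : `[< index_at_least G H n.+1 >] by rewrite ltnn.
apply/asboolP; rewrite -[n in n.+1]card_ord -card_option.
apply: (@index_at_least_fin _ _ _ (fun o : option 'I_n => if o is Some i then r i else x)).
split=> [[i|]//|[i|] [j|]//=]; first by move=> /Hr ->.
  by move=> /(subgroup_sub_sym sH)/nox.
by move=> /nox.
Qed.

(** Transversals of [G] modulo [H], and of [H] modulo [L], are also transversals of [G] modulo [L],
    so [N] bounds their sizes and both indices are finite; the tower law does the rest. *)
Lemma has_index_sub G H L N : subgroup G -> subgroup H -> subgroup L ->
  H `<=` G -> L `<=` H -> has_index G L N ->
  exists n m, [/\ has_index G H n, has_index H L m, (0 < n)%N, (0 < m)%N & N = (n * m)%N].
Proof.
move=> sG sH sL HG LH GN.
have [|||n Hn n0] := @has_index_bound G H N => //; first by case: sG.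
  move=> m [r [Gr Hr]]; apply: (index_at_least_le sL GN); exists r; split=> // i j /LH.
  exact: Hr.
have [|||m Hm m0] := @has_index_bound H L N => //; first by case: sH.
  move=> m [r [Gr Hr]]; apply: (index_at_least_le sL GN); exists r; split=> // i.
  exact/HG.
exists n, m; split=> //; apply: (has_index_uniq sL GN).
exact: (has_index_mul sG sH sL HG LH).
Qed.

(** An intermediate group is a union of cosets of [H], hence determined by the representatives that
    it contains. *)
Lemma finite_between G H n : subgroup H -> has_index G H n ->
  finite_set [set I : set V | [/\ subgroup I, H `<=` I & I `<=` G]].
Proof.
move=> sH [r tr cov].
pose f (s : {set 'I_n}) : set V := [set x | exists2 i, i \in s & H (x - r i)].
apply: (@sub_finite_set _ _ (f @` setT)); last by apply: finite_image; apply: finite_finset.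
move=> I [sI HI IG]; exists [set i | `[< I (r i) >]]%SET => //.
apply/seteqP; split=> x.
  move=> [k]; rewrite inE => /asboolP Irk /HI Ixr.
  by rewrite -(subrK (r k) x); apply: subgroupD.
move=> Ix; have [i Hi] := cov x (IG _ Ix); exists i => //; rewrite inE; apply/asboolP.
by rewrite -[r i](subKr x); apply: sI.2 => //; apply: HI.
Qed.

End Index.

Lemma finite_set_bound T (A : set T) (Q : T -> nat -> Prop) :
  finite_set A -> (forall a n m, (n <= m)%N -> Q a n -> Q a m) ->
  (forall a, A a -> exists n, Q a n) -> exists n, forall a, A a -> Q a n.
Proof.
move=> /finite_setP[n /card_set_bijP[f bf]] mono ex.
have /choice[g gP] : forall a : T, exists n, A a -> Q a n.
  move=> a; have [Aa|nAa] := pselect (A a); last by exists 0%N.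
  by have [k Hk] := ex a Aa; exists k.
pose finv := fun k => if pselect (exists2 a, A a & f a = k) is left w
  then g (projT1 (cid2 w)) else 0%N.
exists (\max_(k < n) finv k) => a Aa.
have fan : (f a < n)%N by have [fs _ _] := bf; apply: fs.
apply: (mono _ (finv (f a))); first by rewrite (leq_bigmax (Ordinal fan)).
rewrite /finv; case: pselect => [w|[]]; last by exists a.
case: cid2 => b Ab /= fba; have [_ inj _] := bf.
have -> : b = a by apply: inj fba; apply/mem_set.
exact: gP.
Qed.

(** * Ideals *)

Lemma det_subring (A : comNzRingType) (S : set A) n (M : 'M[A]_n) :
  S 0 -> S 1 -> (forall x y, S x -> S y -> S (x - y)) ->
  (forall x y, S x -> S y -> S (x * y)) -> (forall i j, S (M i j)) -> S (\det M).
Proof.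
move=> S0 S1 SB SM HM.
have SN x : S x -> S (- x) by move=> Sx; rewrite -sub0r; apply: SB.
have SD x y : S x -> S y -> S (x + y).
  by move=> Sx Sy; rewrite -[y]opprK; apply: SB => //; apply: SN.
rewrite /determinant; elim/big_ind: _ => // s _; rewrite mulr_sign.
suff: S (\prod_i M i (s i)) by case: ifP => // _; apply: SN.
by elim/big_ind: _.
Qed.

Section Ideals.
Variable K : fieldExtType rat.
Local Notation O := (ring_of_integers K).
Implicit Types (I J M D : set K) (x y a b c : K).

Lemma integers_nat n : O n%:R. Proof. exact: integral_nat. Qed.
Lemma integers_int (n : int) : O n%:~R. Proof. exact: integral_id. Qed.
Lemma integers0 : O 0. Proof. exact: (integers_nat 0). Qed.
Lemma integers1 : O 1. Proof. exact: (integers_nat 1). Qed.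
Lemma integersB x y : O x -> O y -> O (x - y). Proof. exact: integral_sub. Qed.
Lemma integersD x y : O x -> O y -> O (x + y). Proof. exact: integral_add. Qed.
Lemma integersM x y : O x -> O y -> O (x * y). Proof. exact: integral_mul. Qed.
Lemma integersN x : O x -> O (- x). Proof. exact: integral_opp. Qed.
Lemma integersX x n : O x -> O (x ^+ n).
Proof.
by move=> Ox; elim: n => [|n IH]; [exact: integers1 | rewrite exprS; apply: integersM].
Qed.
Hint Resolve integers0 integers1 integers_nat integers_int : core.

Lemma integers_subgroup : subgroup O.
Proof. by split=> // x y; apply: integersB. Qed.
Hint Resolve integers_subgroup : core.

Lemma integers_prod (T : Type) (s : seq T) (P : pred T) (F : T -> K) :
  (forall i, P i -> O (F i)) -> O (\prod_(i <- s | P i) F i).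
Proof. by move=> H; elim/big_ind: _ => //; apply: integersM. Qed.

Lemma integers_submodule : is_submodule O.
Proof. by split => //; [exact: integersD | move=> a x; apply: integersM]. Qed.

Lemma submodule_subgroup I : is_submodule I -> subgroup I.
Proof.
move=> sI; split=> [|x y Ix Iy]; first exact: submodule0.
by apply: submoduleD => //; rewrite -mulN1r; apply: submoduleM => //; apply: integersN.
Qed.

Lemma submodule_mulr I x a : is_submodule I -> I x -> O a -> I (x * a).
Proof. by move=> sI Ix Oa; rewrite mulrC; apply: submoduleM. Qed.

Lemma submodule_eq_integers I : is_submodule I -> I `<=` O -> I 1 -> I = O.
Proof.
move=> sI IO I1; apply/seteqP; split=> // x Ox.
by rewrite -[x]mulr1; apply: submoduleM.
Qed.

Definition scale c I : set K := [set c * x | x in I].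

Lemma scaleE c I x : c != 0 -> scale c I x = I (x / c).
Proof.
move=> c0; apply/propext; split=> [[y Iy <-]|Ix]; first by rewrite mulrC mulKf.
by exists (x / c) => //; rewrite mulrC divfK.
Qed.

Lemma scale_mem c I x : I x -> scale c I (c * x). Proof. by exists x. Qed.

Lemma scaleM a b I : scale a (scale b I) = scale (a * b) I.
Proof.
apply/seteqP; split=> x; first by move=> [_ [y Iy <-] <-]; exists y => //; rewrite mulrA.
by move=> [y Iy <-]; exists (b * y); rewrite ?mulrA //; exists y.
Qed.

Lemma scale1 I : scale 1 I = I.
Proof.
apply/seteqP; split=> x; first by move=> [y Iy <-]; rewrite mul1r.
by move=> Ix; exists x; rewrite ?mul1r.
Qed.

Lemma scaleS c I J : I `<=` J -> scale c I `<=` scale c J.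
Proof. by move=> IJ x [y Iy <-]; exists y => //; apply: IJ. Qed.

Lemma scaleK c I : c != 0 -> scale c^-1 (scale c I) = I.
Proof. by move=> c0; rewrite scaleM mulVf // scale1. Qed.

Lemma scaleVK c I : c != 0 -> scale c (scale c^-1 I) = I.
Proof. by move=> c0; rewrite scaleM divff // scale1. Qed.

Lemma scale_subgroup c I : subgroup I -> subgroup (scale c I).
Proof.
move=> [I0 IB]; split; first by exists 0; rewrite ?mulr0.
by move=> _ _ [x Ix <-] [y Iy <-]; exists (x - y); [apply: IB | rewrite mulrBr].
Qed.

Lemma scale_submodule c I : is_submodule I -> is_submodule (scale c I).
Proof.
move=> sI; split; first by exists 0; [exact: submodule0 | rewrite mulr0].
  by move=> _ _ [x Ix <-] [y Iy <-]; exists (x + y); [apply: submoduleD | rewrite mulrDr].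
by move=> a _ Oa [x Ix <-]; exists (a * x); [apply: submoduleM | rewrite mulrCA].
Qed.

Lemma scale_integers_sub I c : is_submodule I -> I c -> scale c O `<=` I.
Proof. by move=> sI Ic _ [x Ox <-]; apply: submodule_mulr. Qed.

Lemma scale_transversal c G H (X : finType) (r : X -> K) : c != 0 ->
  transversal_of G H r -> transversal_of (scale c G) (scale c H) (fun i => c * r i).
Proof.
move=> c0 [Gr Hr]; split=> [i|i j]; first exact: scale_mem.
by rewrite scaleE // -mulrBr mulrC mulKf //; apply: Hr.
Qed.

Lemma has_index_scale c G H n : c != 0 ->
  has_index G H n -> has_index (scale c G) (scale c H) n.
Proof.
move=> c0 [r tr cov]; exists (fun i => c * r i); first exact: scale_transversal.
by move=> _ [x /cov[i Hi] <-]; exists i; rewrite -mulrBr; apply: scale_mem.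
Qed.

(** [fset_set] returns a default value on infinite sets; a finite exhaustive transversal guarantees
    that the cosets are really counted. *)
Lemma ideal_norm_index A n : subgroup A -> has_index O A n -> ideal_norm A = n.
Proof.
move=> sA [r [Or Ar] cov].
pose f (i : 'I_n) := [set y | A (y - r i)].
have -> : ideal_norm A = #|` [fset f i | i in 'I_n]%fset|.
  rewrite /ideal_norm; congr (#|` _|); rewrite -[RHS]set_fsetK; congr fset_set.
  apply/seteqP; split=> X /=.
    move=> [x Ox <-]; have [i Hi] := cov x Ox; apply/imfsetP; exists i => //=.
    apply/seteqP; split=> y /= Hy; apply: (subgroup_trans sA Hy) => //.
    exact: subgroup_sub_sym.
  by move=> /imfsetP[i _ ->]; exists (r i).
rewrite card_imfset /= ?size_enum_ord //.
move=> i j fij; apply: Ar; have : f i (r i) by rewrite /f /= subrr; case: sA.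
by rewrite fij.
Qed.

Lemma ideal_mul_mem I J a b : I a -> J b -> ideal_mul I J (a * b).
Proof. by move=> Ia Jb; exists 1%N, (fun=> a), (fun=> b); rewrite big_ord1. Qed.

Lemma ideal_mul_min I J M : subgroup M ->
  (forall a b, I a -> J b -> M (a * b)) -> ideal_mul I J `<=` M.
Proof.
move=> sM H _ [n [a [b [Hab ->]]]]; apply: subgroup_sum => // i _.
by have [? ?] := Hab i; apply: H.
Qed.

Lemma ideal_mul_submodule I J : is_submodule I -> is_submodule (ideal_mul I J).
Proof.
move=> sI; split.
- by exists 0%N, (fun=> 0), (fun=> 0); split=> [[]//|]; rewrite big_ord0.
- move=> x y [n [a [b [Hab ->]]]] [m [a' [b' [Hab' ->]]]].
  exists (n + m)%N, (fun i => match fintype.split i with inl i => a i | inr i => a' i end),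
    (fun i => match fintype.split i with inl i => b i | inr i => b' i end); split.
    by move=> i; case: fintype.split.
  rewrite big_split_ord /=; congr (_ + _); apply: eq_bigr => i _.
    by rewrite (unsplitK (inl i)).
  by rewrite (unsplitK (inr i)).
- move=> c x Oc [n [a [b [Hab ->]]]]; exists n, (fun i => c * a i), b; split.
    by move=> i; have [? ?] := Hab i; split=> //; apply: submoduleM.
  by rewrite mulr_sumr; apply: eq_bigr => i _; rewrite mulrA.
Qed.

Lemma ideal_mulC I J : ideal_mul I J = ideal_mul J I.
Proof.
by apply/seteqP; split=> x [n [a [b [Hab ->]]]]; exists n, b, a; split;
  [move=> i; have [] := Hab i | apply: eq_bigr => i _; rewrite mulrC |
   move=> i; have [] := Hab i | apply: eq_bigr => i _; rewrite mulrC].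
Qed.

Lemma ideal_mulS I J I' J' : I `<=` I' -> J `<=` J' -> ideal_mul I J `<=` ideal_mul I' J'.
Proof.
move=> II JJ x [n [a [b [Hab ->]]]]; exists n, a, b; split=> // i.
by have [? ?] := Hab i; split; [apply: II | apply: JJ].
Qed.

Lemma ideal_mul_scalel c I J : ideal_mul (scale c I) J = scale c (ideal_mul I J).
Proof.
apply/seteqP; split=> x.
  move=> [n [a [b [Hab ->]]]].
  have /choice[a' Ha'] : forall i, exists y, I y /\ c * y = a i.
    by move=> i; have [[y Iy <-] _] := Hab i; exists y.
  exists (\sum_i a' i * b i).
    by exists n, a', b; split=> // i; split; [exact: (Ha' i).1 | exact: (Hab i).2].
  by rewrite mulr_sumr; apply: eq_bigr => i _; rewrite mulrA (Ha' i).2.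
move=> [_ [n [a [b [Hab ->]]]] <-]; exists n, (fun i => c * a i), b; split.
  by move=> i; have [? ?] := Hab i; split=> //; apply: scale_mem.
by rewrite mulr_sumr; apply: eq_bigr => i _; rewrite mulrA.
Qed.

Lemma ideal_mulA I J M : is_submodule I -> is_submodule J ->
  ideal_mul I (ideal_mul J M) = ideal_mul (ideal_mul I J) M.
Proof.
move=> sI sJ; have s1 := ideal_mul_submodule (ideal_mul J M) sI.
have s2 := ideal_mul_submodule M (ideal_mul_submodule J sI).
apply/seteqP; split.
  apply: ideal_mul_min; first exact: submodule_subgroup.
  move=> a _ Ia [n [b [c [Hbc ->]]]]; rewrite mulr_sumr.
  apply: subgroup_sum; first exact: submodule_subgroup.
  move=> i _; have [? ?] := Hbc i; rewrite mulrA; apply: ideal_mul_mem => //.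
  exact: ideal_mul_mem.
apply: ideal_mul_min; first exact: submodule_subgroup.
move=> _ c [n [a [b [Hab ->]]]] Mc; rewrite mulr_suml.
apply: subgroup_sum; first exact: submodule_subgroup.
move=> i _; have [? ?] := Hab i; rewrite -mulrA; apply: ideal_mul_mem => //.
exact: ideal_mul_mem.
Qed.

Lemma ideal_mul1l I : is_submodule I -> ideal_mul O I = I.
Proof.
move=> sI; apply/seteqP; split.
  apply: ideal_mul_min; first exact: submodule_subgroup.
  by move=> a b; apply: submoduleM.
by move=> x Ix; rewrite -[x]mul1r; apply: ideal_mul_mem.
Qed.

Lemma ideal_exp_submodule I n : is_submodule I -> is_submodule (ideal_exp I n).
Proof.
by move=> sI; case: n => [|n]; [exact: integers_submodule | exact: ideal_mul_submodule].
Qed.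

Lemma ideal_expD I n m : is_submodule I ->
  ideal_mul (ideal_exp I n) (ideal_exp I m) = ideal_exp I (n + m).
Proof.
move=> sI; elim: n => [|n IH]; first by rewrite ideal_mul1l //; apply: ideal_exp_submodule.
by rewrite addSn /= -IH ideal_mulA //; apply: ideal_exp_submodule.
Qed.

Lemma ideal_exp1 I : is_submodule I -> ideal_exp I 1 = I.
Proof. by move=> sI; rewrite /= ideal_mulC ideal_mul1l. Qed.

Lemma ideal_exp_sub1 I n : is_ideal I -> ideal_exp I n.+1 `<=` ideal_exp I n.
Proof.
move=> [IO sI]; rewrite -[X in _ `<=` X]ideal_mul1l; last exact: ideal_exp_submodule.
exact: ideal_mulS.
Qed.

Lemma ideal_exp_leq I n m : is_ideal I -> (n <= m)%N -> ideal_exp I m `<=` ideal_exp I n.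
Proof.
move=> iI /subnK <-; elim: (m - n)%N => [|k IH] //; rewrite addSn.
by move=> x /(ideal_exp_sub1 iI)/IH.
Qed.

Lemma ideal_exp_ideal I n : is_ideal I -> is_ideal (ideal_exp I n).
Proof.
move=> iI; split; last by apply: ideal_exp_submodule; case: iI.
exact: (ideal_exp_leq iI (leq0n n)).
Qed.

Lemma ideal_exp_memX I a n : I a -> ideal_exp I n (a ^+ n).
Proof.
move=> Ia; elim: n => [|n IH]; first exact: integers1.
by rewrite exprS; apply: ideal_mul_mem.
Qed.

Lemma ideal_exp_scale I n m c k : is_submodule I ->
  ideal_exp I n = scale c O -> ideal_exp I (n * k + m) = scale (c ^+ k) (ideal_exp I m).
Proof.
move=> sI Hc; elim: k => [|k IH]; first by rewrite muln0 expr0 scale1.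
rewrite mulnS -addnA -ideal_expD // Hc IH ideal_mul_scalel ideal_mul1l.
  by rewrite scaleM -exprS.
by apply: scale_submodule; apply: ideal_exp_submodule.
Qed.

Definition finitely_generated M := exists n (e : 'I_n -> K),
  (forall i, M (e i)) /\
  forall x, M x -> exists2 c : 'I_n -> K, forall i, O (c i) & x = \sum_i c i * e i.

(** One element of [M] from each coset of [(a)] that meets [M], together with [a], generates [M]; a
    coset missing [M] contributes the dummy generator [0]. *)
Lemma finite_index_fg M a n : is_ideal M -> M a -> has_index O (scale a O) n ->
  finitely_generated M.
Proof.
move=> [MO sM] Ma [r [Or Hr] cov].
have /choice[g gP] : forall i : 'I_n, exists y, M y /\
    ((exists2 x, M x & scale a O (x - r i)) -> scale a O (y - r i)).
  move=> i; have [[y My Hy]|no] := pselect (exists2 x, M x & scale a O (x - r i)).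
    by exists y.
  by exists 0; split=> //; apply: submodule0.
exists n.+1, (fun i => if unlift ord0 i is Some j then g j else a); split.
  by move=> i; case: unlift => // j; apply: (gP j).1.
move=> x Mx; have [i Hi] := cov x (MO _ Mx).
have [c Oc Hc] : scale a O (x - g i).
  have sO := scale_subgroup a integers_subgroup.
  apply: (subgroup_trans sO Hi); apply: subgroup_sub_sym => //; apply: (gP i).2.
  by exists x.
exists (fun k => if unlift ord0 k is Some j then (j == i)%:R else c).
  by move=> k; case: unlift => // j; apply: integers_nat.
rewrite big_ord_recl unlift_none (bigD1 i) //= big1 => [|j ji]; rewrite liftK.
  by rewrite eqxx mul1r addr0 mulrC Hc subrK.
by rewrite (negPf ji) mul0r.
Qed.

Lemma fg_det0 n (X : 'M[K]_n) (e : 'I_n -> K) :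
  (forall i, \sum_j X i j * e j = 0) -> (exists i, e i != 0) -> \det X = 0.
Proof.
move=> H [i ei]; apply/eqP; rewrite -det_tr; apply/det0P.
exists (\row_j e j).
  by apply: contraNneq ei => /rowP/(_ i); rewrite !mxE => ->.
by apply/rowP => k; rewrite !mxE -[RHS](H k); apply: eq_bigr => j _; rewrite !mxE mulrC.
Qed.

(* If [e] generates [M = D M], then [(1 - X) e = 0] with [X] over [D], and
   [det (1 - X) = 0] is [1] modulo [D]. *)
Lemma nakayama D M : is_ideal D -> finitely_generated M -> is_nonzero M ->
  M `<=` ideal_mul D M -> D 1.
Proof.
move=> [DO sD] [n [e [Me gen]]] [x Mx x0] MDM; have gD := submodule_subgroup sD.
have /choice[X HX] : forall i, exists f : 'I_n -> K,
    (forall j, D (f j)) /\ e i = \sum_j f j * e j.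
  move=> i; have [m [u [w [Huw ->]]]] := MDM _ (Me i).
  have /choice[c Hc] : forall l, exists f : 'I_n -> K,
      (forall j, O (f j)) /\ w l = \sum_j f j * e j.
    by move=> l; have [f Of wf] := gen _ (Huw l).2; exists f.
  exists (fun j => \sum_l u l * c l j); split=> [j|].
    by apply: subgroup_sum => // l _; apply: submodule_mulr; [| exact: (Huw l).1 | exact: (Hc l).1].
  under [RHS]eq_bigr do rewrite mulr_suml.
  rewrite exchange_big /=; apply: eq_bigr => l _; rewrite (Hc l).2 mulr_sumr.
  by apply: eq_bigr => j _; rewrite mulrA.
pose Y : 'M[K]_n := \matrix_(i, j) ((i == j)%:R - X i j).
have detY : \det Y = 0.
  apply: (fg_det0 (e := e)) => [i|].
    under eq_bigr do rewrite mxE mulrBl.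
    rewrite sumrB -(HX i).2 (bigD1 i) //= eqxx mul1r big1 ?addr0 ?subrr // => j ji.
    by rewrite eq_sym (negPf ji) mul0r.
  apply: contrapT => /forallNP e0; move: x0; have [c _ ->] := gen x Mx.
  rewrite big1 ?eqxx // => i _; have /negP := e0 i; rewrite negbK => /eqP ->.
  by rewrite mulr0.
have OY i j : O (Y i j) by rewrite mxE; apply: integersB => //; apply: DO; apply: (HX i).1.
(* The identity permutation contributes a product of factors [1 - X i i], congruent to 1; any other
   permutation moves some [i] and so has the factor [- X i (s i)] in [D]. *)
have D_detB1 : D (\det Y - 1).
  rewrite /determinant (bigD1 1%g) //= addrAC; apply: subgroupD => //.
    rewrite odd_perm1 expr0 mul1r.
    under eq_bigr do rewrite perm1 mxE eqxx.
    elim/big_ind: _ => [|u w Hu Hw|i _]; first by rewrite subrr; case: gD.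
      rewrite (_ : u * w - 1 = (u - 1) * (w - 1) + (u - 1) + (w - 1)); last by ring.
      apply: subgroupD => //; apply: subgroupD => //; apply: submoduleM => //.
      exact: DO.
    by rewrite addrAC subrr sub0r; apply: subgroupN => //; apply: (HX i).1.
  apply: subgroup_sum => // s s1.
  have [i si] : exists i, s i != i.
    apply: contrapT => /forallNP s_id; move/eqP: s1; apply; apply/permP => i.
    by rewrite perm1; have /negP := s_id i; rewrite negbK => /eqP.
  rewrite mulr_sign (bigD1 i) //= mxE eq_sym (negPf si) sub0r mulNr.
  have Dp : D (X i (s i) * \prod_(j < n | j != i) Y j (s j)).
    by apply: submodule_mulr => //; [exact: (HX i).1 | apply: integers_prod].
  by case: ifP => _; rewrite ?opprK //; apply: subgroupN.
by rewrite detY sub0r in D_detB1; rewrite -[1]opprK; apply: subgroupN.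
Qed.

(** Determinant trick: [x] acts on generators of [M] through a matrix over [O], so it is a root of
    the characteristic polynomial. The coefficients of that polynomial are only in [O], and
    transitivity of integrality concludes. *)
Lemma multiplier_integral M x : finitely_generated M -> M `<=` O -> is_nonzero M ->
  scale x M `<=` M -> O x.
Proof.
move=> [n [e [Me gen]]] MO [y My y0] xM.
have /choice[X HX] : forall i, exists f : 'I_n -> K,
    (forall j, O (f j)) /\ x * e i = \sum_j f j * e j.
  move=> i; have [|f Of ->] := gen (x * e i); last by exists f.
  by apply: xM; apply: scale_mem.
pose Y : 'M[K]_n := \matrix_(i, j) X i j.
have rootx : root (char_poly Y) x.
  have -> : char_poly Y = \det (char_poly_mx Y) by [].
  rewrite /root -horner_evalE -det_map_mx; apply/eqP.
  set Z := map_mx _ _.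
  have ZE i j : Z i j = (i == j)%:R * x - X i j.
    rewrite !mxE /= /horner_eval hornerD hornerN hornerC hornerMn hornerX.
    by rewrite mulr_natl.
  apply: (fg_det0 (e := e)) => [i|].
    under eq_bigr do rewrite ZE mulrBl.
    rewrite sumrB -(HX i).2 (bigD1 i) //= eqxx mul1r big1 ?addr0 ?subrr // => j ji.
    by rewrite eq_sym (negPf ji) !mul0r.
  apply: contrapT => /forallNP e0; move: y0; have [c _ ->] := gen y My.
  rewrite big1 ?eqxx // => i _; have /negP := e0 i; rewrite negbK => /eqP ->.
  by rewrite mulr0.
apply: (integral_root_monic (char_poly_monic Y) rootx).
apply/integral_poly.
pose S : set {poly K} := [set p | forall i, O p`_i].
have SC c : O c -> S c%:P by move=> Oc i; rewrite coefC; case: eqP.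
suff : S (char_poly Y) by [].
apply: (det_subring (S := S)).
- by move=> i; rewrite coef0.
- exact: SC.
- by move=> p q Sp Sq i; rewrite coefB; apply: integersB.
- move=> p q Sp Sq i; rewrite coefM; apply: subgroup_sum => // j _.
  exact: integersM.
- move=> i j k; rewrite !mxE coefB coefMn coefX -mulrnA; apply: integersB => //.
  by apply: SC; rewrite ?mxE; apply: (HX i).1.
Qed.

End Ideals.

(** * Primitive elements *)

Section PrimitiveElement.
Variable K : fieldExtType rat.
Local Notation O := (ring_of_integers K).
Local Notation inK := (in_alg K).

Lemma in_alg_int (n : int) : inK n%:~R = n%:~R.
Proof. exact: rmorph_int. Qed.

Lemma minimal_rat_poly (x : K) : exists f : {poly rat},
  [/\ f \is monic, separable_poly f, (map_poly inK f).[x] = 0 &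
      forall g, (map_poly inK g).[x] = 0 -> f %| g].
Proof.
have /polyOver1P[f Df] := minPolyOver 1 x; exists f; split.
- by rewrite -(map_monic inK) -Df monic_minPoly.
- rewrite -(separable_map inK) -Df.
  apply: (@pcharf0_separable _ K 1%AS) => p; rewrite pchar_lalg; exact: pchar_num.
- by rewrite -Df minPolyxx.
- move=> g gx0; rewrite -(dvdp_map inK) -Df; apply: minPoly_dvdp; last by rewrite /root gx0.
  by apply/polyOver1P; exists g.
Qed.

(** If [a] clears the denominators of the minimal polynomial [f], of degree [n], then [a x] is a
    root of [a^n f(X / a)], which is monic with integral coefficients [a^(n-i) f_i]. *)
Lemma integral_multiple (x : K) : exists2 a : int, a != 0 & O (a%:~R * x).
Proof.
have [f [mf _ fx _]] := minimal_rat_poly x.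
have [q [a a0 Df]] := rat_poly_scale f.
exists a => //.
have aK0 : a%:~R != 0 :> K.
  by rewrite -in_alg_int fmorph_eq0 intr_eq0.
have fE i : inK (f`_i) = a%:~R^-1 * (q`_i)%:~R.
  by rewrite Df coefZ coef_map rmorphM fmorphV !rmorph_int.
have [n fn] : exists n, size f = n.+1.
  by exists (size f).-1; rewrite prednK // size_poly_gt0 monic_neq0.
have fn1 : f`_n = 1 by move: mf; rewrite monicE /lead_coef fn => /eqP.
pose h : {poly K} := \poly_(i < n.+1) (a%:~R ^+ (n - i) * inK (f`_i)).
have hn : h`_n = 1.
  by rewrite coef_poly ltnSn subnn expr0 fn1 rmorph1 mulr1.
have sh : size h = n.+1.
  by apply/eqP; rewrite size_poly_eq // subnn expr0 fn1 rmorph1 mulr1 oner_neq0.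
apply: (@integral_root_monic _ _ _ _ h).
- by rewrite monicE /lead_coef sh hn.
- rewrite /root horner_coef sh.
  have := fx; rewrite horner_coef size_map_poly fn => Hf.
  apply/eqP; transitivity (a%:~R ^+ n * \sum_(i < n.+1) (map_poly inK f)`_i * x ^+ i).
    rewrite mulr_sumr; apply: eq_bigr => i _.
    rewrite coef_poly ltn_ord coef_map exprMn mulrACA -exprD.
    by rewrite subnK -1?ltnS ?mulrA.
  by rewrite Hf mulr0.
- apply/integral_poly => i; rewrite coef_poly; case: ifP => [|_]; last exact: integral0.
  rewrite ltnS leq_eqVlt => /orP[/eqP->|ltin].
    by rewrite subnn expr0 fn1 rmorph1 mulr1; apply: integral1.
  rewrite -subnSK // exprSr fE -mulrA mulVKf //.
  by apply: integral_mul; [apply: integersX|]; apply: integers_int.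
Qed.

(** A separable generator remains one after multiplication by the nonzero integer [a] that makes it
    integral: substitute [X / a] in the polynomials. *)
Lemma primitive_integer : exists2 t : K, O t &
  forall x, exists g, x = (map_poly inK g).[t].
Proof.
pose t0 := separable_generator (L := K) 1 {:K}.
have full : fullv = <<1; t0>>%VS :> {vspace K}.
  apply: (@eq_adjoin_separable_generator _ K {:K}%AS 1%AS); last exact: subvf.
  by apply/separableP => y _; apply: pcharf0_separable => p; rewrite pchar_lalg; exact: pchar_num.
have [a a0 Oa] := integral_multiple t0; exists (a%:~R * t0) => // x.
have aK0 : a%:~R != 0 :> K by rewrite -in_alg_int fmorph_eq0 intr_eq0.
have : x \in <<1; t0>>%VS by rewrite -full memvf.
move=> /Fadjoin_polyP[p /polyOver1P[g ->] ->].
exists (g \Po ((a%:~R^-1)%:P * 'X)).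
rewrite map_comp_poly horner_comp; congr (_.[_]).
rewrite rmorphM /= map_polyC map_polyX hornerM hornerC hornerX.
transitivity (inK a%:~R^-1 * (a%:~R * t0)); last by [].
by rewrite fmorphV rmorph_int mulKf.
Qed.

End PrimitiveElement.

Section ExtendMorphism.
Variables (K : fieldExtType rat) (L : numFieldType).
Local Notation inK := (in_alg K).

Lemma fmorph_horner_rat (f : {rmorphism K -> L}) (g : {poly rat}) t :
  f (map_poly inK g).[t] = (map_poly ratr g).[f t].
Proof.
rewrite -horner_map -map_poly_comp; congr (_.[_]); apply: eq_map_poly => q /=.
by rewrite rmorphZ_num rmorph1 mulr1.
Qed.

(** The morphism sends [g(t)] to [g(z)]; two polynomials with the same value at [t] differ by a
    multiple of [f], which vanishes at [z]. *)
Lemma extend_root (t : K) (f : {poly rat}) (z : L) :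
  (forall x, exists g, x = (map_poly inK g).[t]) ->
  (forall g, (map_poly inK g).[t] = 0 -> f %| g) ->
  (map_poly ratr f).[z] = 0 -> exists phi : {rmorphism K -> L}, phi t = z.
Proof.
move=> gen fdvd fz; have /choice[co coE] := gen.
pose phi x := (map_poly ratr (co x)).[z].
have phiE g : phi (map_poly inK g).[t] = (map_poly ratr g).[z].
  apply/eqP; rewrite -subr_eq0 /phi -hornerN -hornerD -rmorphB /=.
  have /dvdpP[h ->] : f %| co (map_poly inK g).[t] - g.
    by apply: fdvd; rewrite rmorphB hornerD hornerN -coE subrr.
  by rewrite rmorphM hornerM fz mulr0.
have phiB : zmod_morphism phi.
  move=> x y; rewrite {1}(coE x) {1}(coE y) -hornerN -hornerD -rmorphB /= phiE.
  by rewrite rmorphB hornerD hornerN.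
have phiM : monoid_morphism phi.
  split=> [|x y].
    have := phiE 1; rewrite !rmorph1 !hornerE //.
  rewrite {1}(coE x) {1}(coE y) -hornerM -rmorphM /= phiE.
  by rewrite rmorphM hornerM.
pose A := GRing.isZmodMorphism.Build _ _ phi phiB.
pose M := GRing.isMonoidMorphism.Build _ _ phi phiM.
pose F : {rmorphism K -> L} := HB.pack phi A M.
exists F; have := phiE 'X; rewrite !map_polyX !hornerX /= => <- //.
Qed.

End ExtendMorphism.

(** * Embeddings *)

Section ComplexAbs.
Variable R : realType.
Implicit Types z w : R[i].

(** The norm of [R[i]] takes its values in [R[i]]; the real part recovers the modulus as an element
    of [R]. *)
Definition cabs z : R := complex.Re `|z|.

Lemma cabsE z : `|z| = (cabs z)%:C%C.
Proof. by rewrite /cabs normc_def. Qed.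
Lemma cabs_ge0 z : 0 <= cabs z. Proof. by rewrite -lecR -cabsE normr_ge0. Qed.
Lemma cabsM z w : cabs (z * w) = cabs z * cabs w.
Proof. by apply: complexI; rewrite rmorphM /= -!cabsE normrM. Qed.
Lemma cabsD z w : cabs (z + w) <= cabs z + cabs w.
Proof. by rewrite -lecR rmorphD /= -!cabsE ler_normD. Qed.
Lemma cabsN z : cabs (- z) = cabs z.
Proof. by rewrite /cabs normrN. Qed.
Lemma cabs0 : cabs 0 = 0. Proof. by rewrite /cabs normr0. Qed.
Lemma cabs1 : cabs 1 = 1. Proof. by rewrite /cabs normr1. Qed.
Lemma cabs_eq0 z : (cabs z == 0) = (z == 0).
Proof. by rewrite -[RHS]normr_eq0 cabsE; rewrite -(inj_eq (@complexI R)). Qed.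
Lemma cabsV z : cabs z^-1 = (cabs z)^-1.
Proof. by apply: complexI; rewrite fmorphV /= -!cabsE normfV. Qed.
Lemma cabs_real (x : R) : cabs x%:C%C = `|x|.
Proof. by rewrite /cabs normc_def /= expr0n addr0 sqrtr_sqr. Qed.
Lemma cabsJ z : cabs (conjc z) = cabs z.
Proof. by rewrite /cabs normcJ. Qed.
Lemma cabs_sqr z : cabs z ^+ 2 = complex.Re z ^+ 2 + complex.Im z ^+ 2.
Proof. by rewrite /cabs normc_def /= sqr_sqrtr // addr_ge0 // sqr_ge0. Qed.
Lemma cabs_rat (q : rat) : cabs (ratr q) = `|ratr q|.
Proof. by rewrite -cabs_real fmorph_rat. Qed.
Lemma cabs_sum (T : Type) (s : seq T) (P : pred T) F :
  cabs (\sum_(i <- s | P i) F i) <= \sum_(i <- s | P i) cabs (F i).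
Proof.
elim/big_rec2: _ => [|i x y _ H]; first by rewrite cabs0.
by apply: (le_trans (cabsD _ _)); rewrite lerD2l.
Qed.
Lemma cabs_prod (T : Type) (s : seq T) (P : pred T) F :
  cabs (\prod_(i <- s | P i) F i) = \prod_(i <- s | P i) cabs (F i).
Proof. exact: (big_morph _ cabsM cabs1). Qed.
End ComplexAbs.

Lemma rational_integral (F : numFieldType) (q : rat) :
  integralOver (intr : int -> F) (ratr q) -> exists n : int, q = n%:~R.
Proof.
move=> [p mp rp].
have H : (map_poly intr p : {poly rat}).[q] = 0.
  apply: (fmorph_inj (ratr : {rmorphism rat -> F})).
  rewrite -horner_map /= -map_poly_comp rmorph0 -[RHS](eqP rp); congr (_.[_]).
  by apply: eq_map_poly => n /=; rewrite rmorph_int.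
have : (ratr q : algC) \is a Num.int.
  apply: Cint_rat_Aint; first exact: Crat_rat.
  apply: (@root_monic_Aint (map_poly intr p)).
  - have := congr1 (ratr : {rmorphism rat -> algC}) H.
    rewrite -horner_map /= -map_poly_comp rmorph0 /root => {}H.
    rewrite -[X in _ == X]H; apply/eqP; congr (_.[_]); apply: eq_map_poly => n /=.
    by rewrite rmorph_int.
  - exact: monic_map.
  - by apply/polyOverP => i; rewrite coef_map intr_int.
rewrite Cint_rat => /intrP[m ->]; by exists m.
Qed.

Section Embeddings.
Variables (R : realType) (K : fieldExtType rat) (r1 r2 : nat)
  (sigma : 'I_r1 -> {rmorphism K -> R}) (tau : 'I_r2 -> {rmorphism K -> R[i]}).
Hypothesis Hembed : is_embedding_system sigma tau.
Local Notation inK := (in_alg K).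

(** Each [tau j] is listed with its conjugate, so that all complex embeddings are treated alike and
    the factor [z * conjc z] of the norm splits into two moduli. *)
Definition embedding_index := ('I_r1 + ('I_r2 + 'I_r2))%type.

Definition embedding (k : embedding_index) : {rmorphism K -> R[i]} :=
  match k with
  | inl i => (real_complex R \o sigma i : {rmorphism K -> R[i]})
  | inr (inl j) => tau j
  | inr (inr j) => (@conjc R \o tau j : {rmorphism K -> R[i]})
  end.

Lemma embedding_inj k l : embedding k =1 embedding l -> k = l.
Proof.
have tauNreal j (f : K -> R) : ~ (forall x, tau j x = (f x)%:C%C).
  by move=> H; have [x] := complex_embedding_nonreal Hembed j; rewrite H /= eqxx.
have tauJ j j' : ~ (forall x, tau j x = conjc (tau j' x)).
  move=> H; have jj' : j = j' by apply: (complex_embedding_inj Hembed); right.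
  rewrite -jj' in H; have [x] := complex_embedding_nonreal Hembed j; move/eqP; apply.
  have := congr1 (@complex.Im R) (H x); case: (tau j x) => a b /= /eqP.
  by rewrite -addr_eq0 -mulr2n mulrn_eq0 /= => /eqP.
case: k => [a|[a|a]]; case: l => [b|[b|b]] //= H.
- by congr inl; apply: (real_embedding_inj Hembed) => x; apply: complexI; apply: H.
- by case: (tauNreal b (sigma a)) => x; rewrite -H.
- case: (tauNreal b (sigma a)) => x.
  by apply: (can_inj (@conjcK R)); rewrite -[LHS]/((@conjc R \o tau b) x) -H /= oppr0.
- by case: (tauNreal a (sigma b)) => x; rewrite H.
- by congr (inr (inl _)); apply: (complex_embedding_inj Hembed); left.
- by case: (tauJ a b).
- case: (tauNreal a (sigma b)) => x.
  by apply: (can_inj (@conjcK R)); rewrite -[LHS]/((@conjc R \o tau a) x) H /= oppr0.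
- by case: (tauJ b a) => x; rewrite -H.
- congr (inr (inr _)); apply: (complex_embedding_inj Hembed); left => x.
  by apply: (can_inj (@conjcK R)); apply: H.
Qed.

Lemma embedding_surj (phi : {rmorphism K -> R[i]}) : exists k, phi =1 embedding k.
Proof.
have [[x phix]|nonreal] := pselect (exists x, complex.Im (phi x) != 0).
  have [|j [H|H]] := complex_embedding_surj Hembed (f := phi); first by exists x.
    by exists (inr (inl j)).
  by exists (inr (inr j)).
pose f x := complex.Re (phi x).
have fE x : phi x = (f x)%:C%C.
  have : complex.Im (phi x) = 0.
    by apply: contrapT => /eqP H; apply: nonreal; exists x.
  by rewrite /f; case: (phi x) => a b /= ->.
have fB : zmod_morphism f.
  by move=> x y; apply: complexI; rewrite -fE !rmorphB /= !fE.
have fM : monoid_morphism f.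
  by split=> [|x y]; apply: complexI; rewrite -fE ?rmorph1 // !rmorphM /= !fE.
pose A := GRing.isZmodMorphism.Build _ _ f fB.
pose M := GRing.isMonoidMorphism.Build _ _ f fM.
pose F : {rmorphism K -> R} := HB.pack f A M.
have [i Hi] := real_embedding_surj Hembed F.
by exists (inl i) => x; rewrite fE /= -Hi.
Qed.

Definition degree := #|{: embedding_index}|.

(** Every root of [f] extends to a morphism, which is one of the listed embeddings; so the roots are
    exactly the images of [t], and separability makes them as many as the degree of [f]. This ties
    [r1 + 2 r2] to the degree of [K]. *)
Lemma card_embeddings t f : f \is monic -> separable_poly f ->
  (forall x, exists g, x = (map_poly inK g).[t]) ->
  (map_poly inK f).[t] = 0 -> (forall g, (map_poly inK g).[t] = 0 -> f %| g) ->
  size f = degree.+1 /\ injective (fun k => embedding k t).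
Proof.
move=> mf sf gen ft fdvd.
have inj : injective (fun k => embedding k t).
  move=> k l kl; apply: embedding_inj => x; have [g ->] := gen x.
  by rewrite !fmorph_horner_rat kl.
split=> //.
have [s Ds] := closed_field_poly_normal (map_poly ratr f : {poly R[i]}).
have Df : map_poly ratr f = \prod_(z <- s) ('X - z%:P) :> {poly R[i]}.
  rewrite Ds; have -> : lead_coef (map_poly ratr f : {poly R[i]}) = 1.
    by apply/eqP; rewrite -monicE monic_map.
  by rewrite scale1r.
have us : uniq s by rewrite -separable_prod_XsubC -Df separable_map.
have -> : size f = (size s).+1.
  by rewrite -(size_map_poly (ratr : {rmorphism rat -> R[i]})) /= Df size_prod_XsubC.
congr _.+1; rewrite /degree -[RHS](size_image (fun k => embedding k t)).
apply: perm_size; apply: uniq_perm => //; first by rewrite map_inj_uniq ?enum_uniq.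
move=> z; rewrite -root_prod_XsubC -Df; apply/idP/mapP => [/eqP rz|[k _ ->]].
  have [phi <-] := extend_root gen fdvd rz.
  by have [k Hk] := embedding_surj phi; exists k; rewrite ?mem_enum.
by rewrite /root -fmorph_horner_rat ft rmorph0.
Qed.

End Embeddings.

(** * The norm *)

Section Norm.
Variables (R : realType) (K : fieldExtType rat) (r1 r2 : nat)
  (sigma : 'I_r1 -> {rmorphism K -> R}) (tau : 'I_r2 -> {rmorphism K -> R[i]}).
Hypothesis Hembed : is_embedding_system sigma tau.
Local Notation O := (ring_of_integers K).
Local Notation inK := (in_alg K).
Local Notation emb := (embedding sigma tau).
Local Notation d := (degree r1 r2).

Definition abs_norm (x : K) : R := \prod_k cabs (emb k x).

Lemma abs_normM x y : abs_norm (x * y) = abs_norm x * abs_norm y.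
Proof. by rewrite /abs_norm -big_split; apply: eq_bigr => k _; rewrite rmorphM cabsM. Qed.

Lemma abs_norm_ge0 x : 0 <= abs_norm x.
Proof. by apply: prodr_ge0 => k _; apply: cabs_ge0. Qed.

Lemma abs_norm_gt0 x : x != 0 -> 0 < abs_norm x.
Proof.
by move=> x0; apply: prodr_gt0 => k _; rewrite lt_def cabs_ge0 cabs_eq0 fmorph_eq0 x0.
Qed.

Lemma abs_norm1 : abs_norm 1 = 1.
Proof. by apply: big1 => k _; rewrite rmorph1 cabs1. Qed.

Lemma abs_normX x n : abs_norm (x ^+ n) = abs_norm x ^+ n.
Proof. by elim: n => [|n IH]; rewrite ?expr0 ?abs_norm1 // !exprS abs_normM IH. Qed.

Lemma abs_normV x : x != 0 -> abs_norm x^-1 = (abs_norm x)^-1.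
Proof.
move=> x0; apply: (mulfI (lt0r_neq0 (abs_norm_gt0 x0))).
by rewrite -abs_normM !divff ?abs_norm1 // lt0r_neq0 // abs_norm_gt0.
Qed.

(** * Coordinates in a power basis, and the norm as a determinant *)

Section PowerBasis.
Variable t : K.
Hypotheses (Ot : O t) (gen : forall x, exists g, x = (map_poly inK g).[t]).

Definition em (k : 'I_d) := emb (enum_val k).

Lemma abs_normE x : abs_norm x = \prod_(k < d) cabs (em k x).
Proof.
rewrite /abs_norm (reindex (fun k : 'I_d => enum_val k)) //.
by apply: onW_bij; apply: enum_val_bij.
Qed.

Lemma power_basis_size : exists f, [/\ f \is monic, size f = d.+1,
  (map_poly inK f).[t] = 0 & forall g, (map_poly inK g).[t] = 0 -> f %| g].
Proof.
have [f [mf sf ft fdvd]] := minimal_rat_poly t.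
by have [szf _] := card_embeddings Hembed mf sf gen ft fdvd; exists f.
Qed.

Lemma em_inj : injective (fun k => em k t).
Proof.
have [f [mf sf ft fdvd]] := minimal_rat_poly t.
have [_ inj] := card_embeddings Hembed mf sf gen ft fdvd.
by move=> k l /inj/enum_val_inj.
Qed.

Definition lin (v : 'rV[rat]_d) : K := \sum_j v 0 j *: t ^+ j.

Lemma linB v w : lin (v - w) = lin v - lin w.
Proof. by rewrite -sumrB; apply: eq_bigr => j _; rewrite !mxE scalerBl. Qed.

Lemma linZ a v : lin (a *: v) = a *: lin v.
Proof. by rewrite scaler_sumr; apply: eq_bigr => j _; rewrite !mxE scalerA. Qed.

Lemma lin_poly v : lin v = (map_poly inK (rVpoly v)).[t].
Proof.
rewrite (@horner_coef_wide _ d) ?(leq_trans (size_poly _ _)) // ?size_map_poly ?size_poly //.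
by apply: eq_bigr => j _; rewrite coef_map /= coef_rVpoly_ord mulr_algl.
Qed.

Lemma lin_inj0 v : lin v = 0 -> v = 0.
Proof.
have [f [mf sf _ fdvd]] := power_basis_size.
rewrite lin_poly => /fdvd fv; rewrite -[v]rVpolyK.
have [->|nz] := eqVneq (rVpoly v) 0; first by apply/rowP => j; rewrite !mxE coef0.
by have := dvdp_leq nz fv; rewrite sf => /leq_trans/(_ (size_poly _ _)); rewrite ltnn.
Qed.

Lemma lin_inj : injective lin.
Proof.
by move=> v w vw; apply/eqP; rewrite -subr_eq0; apply/eqP; apply: lin_inj0;
  rewrite linB vw subrr.
Qed.

Lemma lin_surj x : exists v, lin v = x.
Proof.
have [f [mf sf ft _]] := power_basis_size; have [g ->] := gen x.
exists (poly_rV (g %% f)); rewrite lin_poly poly_rV_K; last first.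
  by rewrite -ltnS -sf ltn_modp monic_neq0.
by rewrite {2}(divp_eq g f) rmorphD rmorphM hornerD hornerM ft mulr0 add0r.
Qed.

Definition coords x := sval (cid (lin_surj x)).

Lemma linK : cancel coords lin.
Proof. by move=> x; rewrite /coords; case: cid. Qed.

Lemma coordsK : cancel lin coords.
Proof. by move=> v; apply: lin_inj; rewrite linK. Qed.

Lemma coordsB x y : coords (x - y) = coords x - coords y.
Proof. by apply: lin_inj; rewrite linB !linK. Qed.

Lemma em_lin k v : em k (lin v) = \sum_j ratr (v 0 j) * em k t ^+ j.
Proof. by rewrite rmorph_sum; apply: eq_bigr => j _; rewrite rmorphZ_num rmorphXn. Qed.

Definition mulmat c : 'M[rat]_d := \matrix_(j, l) coords (c * t ^+ j) 0 l.

Lemma row_mulmat c j : lin (row j (mulmat c)) = c * t ^+ j.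
Proof. by rewrite -[RHS]linK; congr lin; apply/rowP => l; rewrite !mxE. Qed.

Lemma lin_mulmat c v : lin (v *m mulmat c) = c * lin v.
Proof.
rewrite mulr_sumr; under [RHS]eq_bigr do rewrite -scalerAr -row_mulmat scaler_sumr.
rewrite exchange_big /=; apply: eq_bigr => l _; rewrite mxE scaler_suml.
by apply: eq_bigr => j _; rewrite scalerA !mxE.
Qed.

Definition power_matrix : 'M[R[i]]_d := \matrix_(j, k) em k t ^+ j.

(** A row in the kernel of this Vandermonde matrix would be a nonzero polynomial with fewer than
    [d + 1] coefficients and [d] distinct roots. *)
Lemma det_power_matrix_neq0 : \det power_matrix != 0.
Proof.
apply/det0P => -[v /negP v0 vE]; apply: v0; apply/eqP; rewrite -[v]rVpolyK.
have [->|nz] := eqVneq (rVpoly v) 0; first by apply/rowP => j; rewrite !mxE coef0.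
have := @max_poly_roots _ (rVpoly v) [seq em k t | k <- enum 'I_d] nz.
have -> : all (root (rVpoly v)) [seq em k t | k <- enum 'I_d].
  apply/allP => _ /mapP[k _ ->]; apply/eqP.
  rewrite (@horner_coef_wide _ d) ?size_poly //.
  transitivity ((v *m power_matrix) 0 k); last by rewrite vE mxE.
  by rewrite mxE; apply: eq_bigr => j _; rewrite coef_rVpoly_ord mxE.
rewrite map_inj_uniq ?enum_uniq; last exact: em_inj.
rewrite size_map size_enum_ord => /(_ isT isT).
by move=> /leq_trans/(_ (size_poly _ _)); rewrite ltnn.
Qed.

(** The Vandermonde matrix conjugates multiplication by [c] to the diagonal matrix of the embeddings
    of [c]. *)
Lemma det_mulmat c : ratr (\det (mulmat c)) = \prod_k em k c :> R[i].
Proof.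
have H : map_mx ratr (mulmat c) *m power_matrix
    = power_matrix *m diag_mx (\row_k em k c).
  apply/matrixP => j k; rewrite mul_mx_diag !mxE -[em k t ^+ j]rmorphXn /=.
  rewrite -rmorphM mulrC -row_mulmat em_lin.
  by apply: eq_bigr => l _; rewrite !mxE.
have := congr1 determinant H; rewrite !det_mulmx det_diag mulrC => /(mulfI det_power_matrix_neq0).
rewrite det_map_mx => ->; by apply: eq_bigr => k _; rewrite mxE.
Qed.

Lemma abs_norm_det c : abs_norm c = `|ratr (\det (mulmat c))|.
Proof. by rewrite abs_normE -cabs_prod -det_mulmat cabs_rat. Qed.

Lemma em_integral k x : O x -> integralOver (intr : int -> R[i]) (em k x).
Proof.
move=> [p mp rp]; exists p => //; apply/eqP.
rewrite -(rmorph0 (em k)) -(eqP rp) -horner_map -map_poly_comp; congr (_.[_]).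
by apply: eq_map_poly => n /=; rewrite rmorph_int.
Qed.

(** The determinant is rational, and integral as a product of conjugates of [c]; hence it is a
    nonzero integer. *)
Lemma integral_norm_ge1 c : O c -> c != 0 -> 1 <= abs_norm c.
Proof.
move=> Oc c0; have [|n Hn] := @rational_integral R[i] (\det (mulmat c)).
  rewrite det_mulmat; elim/big_ind: _ => [|x y|k _]; first exact: integral1.
    exact: integral_mul.
  exact: em_integral.
have := abs_norm_gt0 c0; rewrite abs_norm_det Hn rmorph_int normr_gt0 intr_eq0.
by rewrite -intr_norm ler1z -gtz0_ge1 normr_gt0.
Qed.

Lemma degree_gt0 : (0 < d)%N.
Proof.
rewrite lt0n; apply/negP => /eqP d0.
have : lin (coords 1) = 0 by rewrite /lin; move: (coords 1); rewrite d0 => v; rewrite big_ord0.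
by rewrite linK; apply/eqP; apply: oner_neq0.
Qed.

End PowerBasis.
End Norm.

(** * The index of a principal ideal *)

Lemma has_index_inj (V W : zmodType) (phi : V -> W) (G H : set V) n :
  zmod_morphism phi -> injective phi -> has_index G H n ->
  has_index (phi @` G) (phi @` H) n.
Proof.
move=> phiB inj [r [Gr Hr] cov]; exists (fun i => phi (r i)).
  split=> [i|i j]; first by exists (r i).
  by rewrite -phiB => -[x Hx /inj xE]; apply: Hr; rewrite -xE.
by move=> _ [x /cov[i Hi] <-]; exists i; rewrite -phiB; exists (x - r i).
Qed.

Lemma index_diag n (e : 'I_n -> int) : (forall i, e i != 0) ->
  has_index [set: 'rV[int]_n] [set w : 'rV_n | forall i, (e i %| w 0%R i)%Z]
    (\prod_i `|e i|)%N.
Proof.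
move=> e0.
have -> : (\prod_i `|e i| = #|{dffun forall i : 'I_n, 'I_(`|e i|)}|)%N.
  rewrite card_dep_ffun /image_mem -[RHS]/(foldr _ _ _) foldrE big_map enumT /=.
  by apply: eq_bigr => i _; rewrite card_ord.
apply: (has_index_fin (r := fun f : {dffun forall i : 'I_n, 'I_(`|e i|)} =>
  (\row_i (f i : nat)%:Z : 'rV[int]_n))).
  split=> // f g H; apply/ffunP => i; apply/val_inj => /=.
  have := H i; rewrite !mxE -eqz_mod_dvd => /eqP.
  rewrite -(modz_abs _ (e i)) -[in RHS](modz_abs _ (e i)).
  by rewrite !modz_small ?lez_nat ?ltz_nat ?ltn_ord // => -[].
move=> v _.
have lt_mod i : (`|(v 0%R i %% e i)%Z| < `|e i|)%N.
  rewrite -ltz_nat gez0_abs ?modz_ge0 //; exact: ltz_mod.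
exists (finfun (fun i => Ordinal (lt_mod i))) => i /=.
rewrite !mxE ffunE /= gez0_abs ?modz_ge0 // -eqz_mod_dvd.
by rewrite modz_mod.
Qed.

Lemma abs_det_unitmx n (U : 'M[int]_n) : U \in unitmx -> `|\det U|%N = 1%N.
Proof.
by move=> Uu; have := congr1 absz (congr1 determinant (mulmxV Uu));
  rewrite det_mulmx det1 abszM => /eqP; rewrite muln_eq1 => /andP[/eqP].
Qed.

(* By the Smith normal form [M] is diagonal up to unimodular factors. *)
Lemma index_det n (M : 'M[int]_n) : \det M != 0 ->
  has_index [set: 'rV[int]_n] (range (fun v : 'rV_n => v *m M)) `|\det M|%N.
Proof.
have [L Lu [U Uu [e _ ->]]] := int_Smith_normal_form M.
set D := \matrix_(i, j) _.
have DE : D = diag_mx (\row_(i < n) e`_i).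
  by apply/matrixP => i j; rewrite !mxE -val_eqE.
rewrite !det_mulmx !abszM (abs_det_unitmx Lu) (abs_det_unitmx Uu) mul1n muln1.
rewrite !mulf_eq0 !negb_or DE det_diag.
move=> /andP[/andP[_ D0] _].
have e0 (i : 'I_n) : e`_i != 0.
  by move/prodf_neq0/(_ i isT): D0; rewrite mxE.
have := has_index_inj (phi := fun v : 'rV[int]_n => v *m U) _ _ (index_diag e0).
have absz_prod (F : 'I_n -> int) : absz (\prod_i F i) = (\prod_i absz (F i))%N.
  exact: (big_morph absz abszM (erefl : absz 1 = 1%N)).
rewrite absz_prod; under [X in _ -> has_index _ _ X]eq_bigr do rewrite mxE.
set A := image _ _; set B := image _ _.
have -> : A = setT.
  apply/seteqP; split=> // v _; exists (v *m invmx U) => //.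
  by rewrite mulmxKV.
have -> : B = range (fun v : 'rV_n => v *m (L *m diag_mx (\row_(i < n) e`_i) *m U)).
  apply/seteqP; split=> v.
    move=> [w Hw <-].
    have /choice[u Hu] : forall i, exists q, w 0 i = q * e`_i.
      by move=> i; have /dvdzP[q] := Hw i; exists q.
    exists ((\row_i u i) *m invmx L) => //; rewrite !mulmxA mulmxKV //.
    by congr (_ *m _); apply/rowP => i; rewrite mul_mx_diag !mxE Hu.
  move=> [w _ <-]; exists (w *m L *m diag_mx (\row_(i < n) e`_i)); rewrite ?mulmxA //.
  by move=> i; rewrite mul_mx_diag !mxE dvdz_mull.
by apply=> [x y|x y]; [rewrite mulmxBl | move/(can_inj (mulmxK Uu))].
Qed.

Section PrincipalIndex.
Variables (R : realType) (K : fieldExtType rat) (r1 r2 : nat)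
  (sigma : 'I_r1 -> {rmorphism K -> R}) (tau : 'I_r2 -> {rmorphism K -> R[i]}).
Hypothesis Hembed : is_embedding_system sigma tau.
Local Notation O := (ring_of_integers K).
Local Notation inK := (in_alg K).
Local Notation d := (degree r1 r2).
Local Notation abs_norm := (abs_norm sigma tau).
Local Notation em := (em sigma tau).

Section Lattice.
Variable t : K.
Hypotheses (Ot : O t) (gen : forall x, exists g, x = (map_poly inK g).[t]).
Local Notation lin := (@lin K r1 r2 t).
Local Notation coords := (coords Hembed gen).
Local Notation mulmat := (mulmat Hembed gen).

Definition int_lin (v : 'rV[int]_d) : K := lin (map_mx intr v).

Lemma int_linE v : int_lin v = \sum_j (v 0 j)%:~R * t ^+ j.
Proof. by apply: eq_bigr => j _; rewrite mxE scaler_int mulrzl. Qed.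

Lemma int_linB : zmod_morphism int_lin.
Proof.
move=> v w; rewrite -linB; congr lin.
by apply/rowP => j; rewrite !mxE rmorphB.
Qed.

Lemma int_lin_inj : injective int_lin.
Proof.
move=> v w /(lin_inj Hembed gen)/rowP H; apply/rowP => j; have := H j; rewrite !mxE.
exact: intr_inj.
Qed.

Lemma int_lin_integral v : O (int_lin v).
Proof.
rewrite int_linE; apply: subgroup_sum; first exact: integers_subgroup.
by move=> j _; apply: integersM; [exact: integers_int | exact: integersX].
Qed.

Definition lattice : set K := range int_lin.

Lemma lattice_subgroup : subgroup lattice.
Proof.
split; first by exists 0 => //; rewrite int_linE big1 // => j _; rewrite mxE mul0r.
by move=> _ _ [v _ <-] [w _ <-]; exists (v - w) => //; rewrite int_linB.
Qed.

Lemma lattice_sub : lattice `<=` O.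
Proof. by move=> _ [v _ <-]; apply: int_lin_integral. Qed.

Lemma index_lattice_scale c (M : 'M[int]_d) : c != 0 -> mulmat c = map_mx intr M ->
  scale c lattice `<=` lattice /\
  exists2 n, has_index lattice (scale c lattice) n & n%:R = abs_norm c.
Proof.
move=> c0 HM.
have cE v : c * int_lin v = int_lin (v *m M).
  by rewrite -(lin_mulmat Hembed gen) HM -map_mxM.
have NE : abs_norm c = `|\det M|%:~R.
  by rewrite (abs_norm_det Hembed gen) HM det_map_mx /= ratr_int intr_norm.
have detM0 : \det M != 0.
  by have := abs_norm_gt0 sigma tau c0; rewrite NE ltr0z normr_gt0.
have -> : scale c lattice = int_lin @` range (fun v : 'rV_d => v *m M).
  apply/seteqP; split=> x.
    by move=> [_ [v _ <-] <-]; exists (v *m M); [exists v | rewrite cE].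
  by move=> [_ [v _ <-] <-]; exists (int_lin v); [exists v | rewrite cE].
split; first by move=> _ [v _ <-]; exists v.
exists `|\det M|%N; last by rewrite NE -abszE.
exact: has_index_inj int_linB int_lin_inj (index_det detM0).
Qed.

Lemma prod_lt1 (F : 'I_d -> R) : (forall k, 0 <= F k < 1) -> \prod_k F k < 1.
Proof.
move=> HF; rewrite (bigD1 (Ordinal (degree_gt0 Hembed gen))) //=.
apply: (le_lt_trans (ler_pM _ _ (lexx _) (_ : _ <= 1))).
- by case/andP: (HF (Ordinal (degree_gt0 Hembed gen))).
- by apply: prodr_ge0 => k _; case/andP: (HF k).
- by apply: prodr_ile1 => k _; case/andP: (HF k) => -> /ltW.
- by rewrite mulr1; case/andP: (HF (Ordinal (degree_gt0 Hembed gen))).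
Qed.

(** By the triangle inequality [Z] bounds all embeddings of combinations of powers of [t] with
    coefficients in [[-1, 1]]. The lattice index, the balanced generators and the compactness
    argument all use it. *)
Lemma em_bound : exists2 Z : R, 0 < Z &
  forall k, \sum_(j < d) cabs (em k t ^+ j) <= Z.
Proof.
exists (1 + \sum_k \sum_(j < d) cabs (em k t ^+ j)).
  by rewrite ltr_wpDr // !sumr_ge0 // => k _; rewrite sumr_ge0 // => j _; apply: cabs_ge0.
move=> k; rewrite [X in _ <= _ + X](bigD1 k) //= addrCA lerDl addr_ge0 // sumr_ge0 // => l _.
by rewrite sumr_ge0 // => j _; apply: cabs_ge0.
Qed.

(* A transversal of [O] modulo the lattice is told apart by the integer parts of
   [N] times the fractional parts of the coordinates: an integer of [K] all of
   whose embeddings have absolute value less than 1 vanishes. *)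
Lemma lattice_finite_index : exists2 n, has_index O lattice n & (0 < n)%N.
Proof.
have [Z Z0 HZ] := em_bound; have := archi_boundP (ltW Z0).
(* Since [N > Z], coordinates smaller than [1 / N] give embeddings smaller than [Z / N < 1]. *)
set N := Num.Def.archi_bound Z => ZN.
have N0 : (0 < N)%N by rewrite -(ltr_nat R); apply: lt_trans ZN.
apply: (has_index_bound (N := #|{ffun 'I_d -> 'I_N}|)).
- exact: lattice_subgroup.
- exact: integers0.
move=> m [r [Or Lr]].
pose fr i j := coords (r i) 0 j - (Num.floor (coords (r i) 0 j))%:~R.
have fr_itv i j : 0 <= fr i j < 1.
  have := floor_itv (coords (r i) 0 j); rewrite intrD /fr => /andP[? ?].
  by apply/andP; split; lra.
have tr_lt i j : (Num.truncn (N%:R * fr i j) < N)%N.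
  have /andP[f0 f1] := fr_itv i j.
  by rewrite truncn_lt_nat ?mulr_ge0 // -[ltRHS]mulr1 ltr_pM2l // ltr0n.
pose phi i : {ffun 'I_d -> 'I_N} := [ffun j => Ordinal (tr_lt i j)].
suff inj_phi : injective phi by have := leq_card phi inj_phi; rewrite card_ord.
move=> i i' ii'; apply: Lr.
pose v : 'rV[int]_d := \row_j (Num.floor (coords (r i) 0 j) - Num.floor (coords (r i') 0 j)).
set x := r i - r i'; exists v => //; apply/eqP; rewrite eq_sym -subr_eq0.
set y := x - int_lin v; apply: contraTT isT => y0.
have Oy : O y.
  by apply: integersB; [apply: integersB | exact: int_lin_integral].
have cy j : coords y 0 j = fr i j - fr i' j.
  by rewrite !coordsB /int_lin coordsK !mxE rmorphB /= /fr; ring.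
have cy_lt j : `|coords y 0 j| < N%:R^-1.
  rewrite cy -[ltRHS]mul1r ltr_pdivlMr ?ltr0n // -[X in _ * X]normr_nat -normrM.
  rewrite mulrBl ![_ * N%:R]mulrC.
  have /(congr1 val)/= trE : phi i j = phi i' j by rewrite ii'.
  move: trE; rewrite !ffunE /= => trE.
  have g0 l : 0 <= N%:R * fr l j by case/andP: (fr_itv l j) => ? _; rewrite mulr_ge0.
  have := truncn_itv (g0 i); have := truncn_itv (g0 i'); rewrite trE -natr1.
  move=> /andP[? ?] /andP[? ?].
  by rewrite ltr_norml; lra.
have := integral_norm_ge1 Hembed gen Oy y0.
rewrite leNgt => /negP; case; rewrite abs_normE; apply: prod_lt1 => k.
rewrite cabs_ge0 /= -(linK Hembed gen y) em_lin.
apply: (le_lt_trans (cabs_sum _ _ _)).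
apply: (@le_lt_trans _ _ (N%:R^-1 * Z)); last by rewrite mulrC ltr_pdivrMr ?ltr0n // mul1r.
apply: (@le_trans _ _ (\sum_(j < d) N%:R^-1 * cabs (em k t ^+ j))).
  apply: ler_sum => j _; rewrite cabsM cabs_rat ler_wpM2r ?cabs_ge0 //.
  by have := ltW (cy_lt j); rewrite -(ler_rat R) ratr_norm fmorphV rmorph_nat.
by rewrite -mulr_sumr ler_wpM2l // invr_ge0 ler0n.
Qed.

Lemma common_denominator c : exists a (M : 'M[int]_d),
  [/\ a != 0 & mulmat (a%:~R * c) = map_mx intr M].
Proof.
pose a := \prod_i \prod_j denq (mulmat c i j).
exists a, (\matrix_(i, j) numq (a%:~R * mulmat c i j)).
have a0 : a != 0 by apply/prodf_neq0 => i _; apply/prodf_neq0 => j _; apply: denq_neq0.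
split=> //; apply/matrixP => i j.
have -> : mulmat (a%:~R * c) i j = a%:~R * mulmat c i j.
  rewrite !mxE -mulrA -[X in coords X](_ : lin (a%:~R *: coords (c * t ^+ i)) = _).
    by rewrite coordsK mxE.
  by rewrite linZ linK scaler_int mulrzl.
rewrite [RHS]mxE [X in _ = X%:~R]mxE; suff /intrP[m ->] : a%:~R * mulmat c i j \is a Num.int.
  by rewrite numq_int.
have [b ->] : exists b : int, a = b * denq (mulmat c i j).
  exists ((\prod_(k < d | k != i) \prod_j denq (mulmat c k j)) *
    \prod_(k < d | k != j) denq (mulmat c i k)).
  by rewrite /a (bigD1 i) //= [X in X * _](bigD1 j) //= mulrC mulrA mulrAC.
by rewrite rmorphM /= -mulrA [X in _ * X]mulrC -numqE -rmorphM /= intr_int.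
Qed.

End Lattice.

(* The index is compared with that of the lattice spanned by the powers of an
   integral primitive element. *)
Lemma index_principal c : O c -> c != 0 ->
  exists2 n, has_index O (scale c O) n & n%:R = abs_norm c.
Proof.
move=> Oc c0; have [t Ot gen] := primitive_integer K.
have sO := @integers_subgroup K.
have sL := lattice_subgroup t; have LO := lattice_sub Ot.
have [n0 n0P n0_gt0] := lattice_finite_index Ot gen.
(* For [e] preserving the lattice [L], compare [[O : L] [L : eL] = [O : eO] [eO : eL]] and cancel
   [[eO : eL] = [O : L]]. *)
have key e (M : 'M[int]_d) : O e -> e != 0 -> mulmat Hembed gen e = map_mx intr M ->
    exists2 n, has_index O (scale e O) n & n%:R = abs_norm e.
  move=> Oe e0 /(index_lattice_scale e0)[eLL [n nP nE]]; exists n => //.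
  have H1 := has_index_mul sO sL (scale_subgroup e sL) LO eLL n0P nP.
  have eLO : scale e (lattice t) `<=` scale e O by apply: scaleS.
  have eOO : scale e O `<=` O by apply: scale_integers_sub => //; apply: integers_submodule.
  have [a [b [Ha Hb a0 b0 ab]]] :=
    has_index_sub sO (scale_subgroup e sO) (scale_subgroup e sL) eOO eLO H1.
  have bn0 := has_index_uniq (scale_subgroup e sL) Hb (has_index_scale e0 n0P).
  suff -> : n = a by [].
  by apply/eqP; rewrite -(eqn_pmul2l n0_gt0) ab bn0 mulnC.
(* A general [c] need not preserve the lattice, but [a] and [a c] do for a common denominator [a];
   then divide [[O : acO]] by [[O : aO]]. *)
have [a [M [a0 HM]]] := common_denominator gen c.
have aK0 : a%:~R != 0 :> K by rewrite -in_alg_int fmorph_eq0 intr_eq0.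
have [na naP naE] : exists2 n, has_index O (scale a%:~R O) n & n%:R = abs_norm a%:~R.
  apply: (key _ a%:M) => //; first exact: integers_int.
  apply/matrixP => i j; rewrite !mxE.
  rewrite -[X in coords _ _ X](_ : @lin K r1 r2 t (a%:~R *: delta_mx 0 i) = _).
    by rewrite coordsK !mxE eqxx /= rmorphMn /= mulr_natr eq_sym.
  rewrite linZ scaler_int mulrzl /lin (bigD1 i) //= mxE !eqxx scale1r big1 ?addr0 // => l li.
  by rewrite mxE (negPf li) andbF scale0r.
have [nac nacP nacE] := key _ _ (integersM (integers_int _ a) Oc) (mulf_neq0 aK0 c0) HM.
have aOO : scale a%:~R O `<=` O.
  by apply: scale_integers_sub; [exact: integers_submodule | exact: integers_int].
have cOO : scale c O `<=` O by apply: scale_integers_sub => //; exact: integers_submodule.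
have acO : scale (a%:~R * c) O `<=` scale a%:~R O by rewrite -scaleM; apply: scaleS.
have [u [v [Hu Hv u0 v0 uv]]] := has_index_sub sO (scale_subgroup a%:~R sO)
  (scale_subgroup (a%:~R * c) sO) aOO acO nacP.
have Hc := has_index_scale (invr_neq0 aK0) Hv.
rewrite -scaleM !scaleK // in Hc; exists v => //.
have una := has_index_uniq (scale_subgroup _ sO) Hu naP.
apply: (mulfI (lt0r_neq0 (abs_norm_gt0 sigma tau aK0))).
by rewrite -abs_normM -nacE uv natrM una naE.
Qed.

End PrincipalIndex.

(** * Norms and classes of ideals *)

Lemma finite_pigeonhole T (A : set T) (g : nat -> T) :
  finite_set A -> (forall i, A (g i)) -> exists i j, (i < j)%N /\ g i = g j.
Proof.
move=> /finite_setP[n /card_set_bijP[f [fA finj _]]] Ag.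
have fn i : (f (g i) < n)%N by apply: fA.
pose F (i : 'I_n.+1) := Ordinal (fn i).
have [i [j ij Fij]] : exists i, exists2 j, i != j & F i = F j.
  apply/injectivePn; apply/negP => /injectiveP/leq_card.
  by rewrite !card_ord ltnn.
have gij : g i = g j by apply: finj (congr1 val Fij); apply/mem_set.
have [lt_ij|lt_ji|/val_inj eq_ij] := ltngtP i j; last by rewrite eq_ij eqxx in ij.
  by exists i, j.
by exists j, i.
Qed.

Section IdealNorm.
Variables (R : realType) (K : fieldExtType rat) (r1 r2 : nat)
  (sigma : 'I_r1 -> {rmorphism K -> R}) (tau : 'I_r2 -> {rmorphism K -> R[i]}).
Hypothesis Hembed : is_embedding_system sigma tau.
Local Notation O := (ring_of_integers K).
Local Notation inK := (in_alg K).
Local Notation emb := (embedding sigma tau).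
Local Notation d := (degree r1 r2).
Local Notation abs_norm := (abs_norm sigma tau).
Local Notation em := (em sigma tau).
Implicit Types (A I J P : set K).

Lemma ideal_index A : is_ideal A -> is_nonzero A ->
  has_index O A (ideal_norm A) /\ (0 < ideal_norm A)%N.
Proof.
move=> [AO sA] [a Aa a0].
have [n nP _] := index_principal Hembed (AO _ Aa) a0.
have gA := submodule_subgroup sA.
have [u [v [Hu _ u0 _ _]]] := has_index_sub (@integers_subgroup K) gA
  (scale_subgroup a (@integers_subgroup K)) AO (scale_integers_sub sA Aa) nP.
by rewrite (ideal_norm_index gA Hu).
Qed.

Lemma is_ideal_fg A : is_ideal A -> is_nonzero A -> finitely_generated A.
Proof.
move=> iA [a Aa a0]; have [n nP _] := index_principal Hembed (iA.1 _ Aa) a0.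
exact: finite_index_fg iA Aa nP.
Qed.

Lemma index_scale_ideal A a : is_ideal A -> is_nonzero A -> O a -> a != 0 ->
  exists2 n, has_index O (scale a A) n & n%:R = abs_norm a * (ideal_norm A)%:R.
Proof.
move=> iA nA Oa a0; have [HA _] := ideal_index iA nA.
have gA := submodule_subgroup iA.2; have gO := @integers_subgroup K.
have [n nP nE] := index_principal Hembed Oa a0.
exists (n * ideal_norm A)%N; last by rewrite natrM nE.
apply: (has_index_mul gO (scale_subgroup a gO) (scale_subgroup a gA) _ _ nP).
- exact: scale_integers_sub (@integers_submodule K) Oa.
- by apply: scaleS; case: iA.
- exact: has_index_scale.
Qed.

(** As [c] may be fractional, take an integer [b] with [b c] integral and compute the index of
    [b c A] both from [A] and from [c A]. *)
Lemma ideal_norm_scale A c : is_ideal A -> is_nonzero A -> c != 0 ->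
  is_ideal (scale c A) -> (ideal_norm (scale c A))%:R = abs_norm c * (ideal_norm A)%:R.
Proof.
move=> iA nA c0 icA; have [b b0 Oa] := integral_multiple c.
have bK0 : b%:~R != 0 :> K by rewrite -in_alg_int fmorph_eq0 intr_eq0.
have ncA : is_nonzero (scale c A).
  by case: nA => x Ax x0; exists (c * x); [apply: scale_mem | rewrite mulf_neq0].
have [n nP nE] := index_scale_ideal iA nA Oa (mulf_neq0 bK0 c0).
have [m mP mE] := index_scale_ideal icA ncA (integers_int _ b) bK0.
rewrite scaleM in mP.
have nm := has_index_uniq (scale_subgroup _ (submodule_subgroup iA.2)) nP mP.
apply: (mulfI (lt0r_neq0 (abs_norm_gt0 sigma tau bK0))).
by rewrite -mE -nm nE abs_normM mulrA.
Qed.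

Lemma nth_root_floor n k : (0 < n)%N -> (0 < k)%N ->
  exists m, (m ^ k <= n < m.+1 ^ k)%N.
Proof.
move=> n0 k0.
have ex1 : exists m, (m ^ k <= n)%N by exists 0%N; rewrite exp0n.
have ub m : (m ^ k <= n)%N -> (m <= n)%N.
  move=> H; apply: leq_trans H; case: m => // m.
  by rewrite -[X in (X <= _)%N]expn1 leq_pexp2l.
case: (ex_maxnP ex1 ub) => m Hm mmax; exists m; rewrite Hm ltnNge.
by apply/negP => /mmax; rewrite ltnn.
Qed.

(** For the element [p] found by pigeonhole, [(p)] has index at most [M] in [I], with [M] depending
    on [K] only. Hence [M!] kills the quotient and [p^-1 I] lies between [O] and [(1 / M!) O]; [F]
    is the finite set of subgroups in between. *)
Lemma balanced_generators : exists (Z : R) (F : set (set K)),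
  [/\ 0 < Z, finite_set F & forall I, is_ideal I -> is_nonzero I -> exists p m,
    [/\ I p, p != 0, (m ^ d <= ideal_norm I < m.+1 ^ d)%N,
        forall k, cabs (emb k p) <= Z * m%:R & F (scale p^-1 I)]].
Proof.
have [t Ot gen] := primitive_integer K.
have [Z Z0 HZ] := em_bound sigma tau t.
have := archi_boundP (exprn_ge0 d (ltW Z0)).
set M := Num.Def.archi_bound (Z ^+ d) => ZM.
have gO := @integers_subgroup K.
have MK0 : M`!%:R != 0 :> K.
  by rewrite -(rmorph_nat inK) fmorph_eq0 pnatr_eq0 -lt0n fact_gt0.
exists Z, [set J | [/\ subgroup J, O `<=` J & J `<=` scale M`!%:R^-1 O]]; split=> //.
  have [n nP _] := index_principal Hembed (integers_nat K M`!) MK0.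
  have := has_index_scale (invr_neq0 MK0) nP; rewrite scaleK // => nP'.
  exact: (finite_between gO nP').
move=> I iI nI; have [HI N0] := ideal_index iI nI.
have gI := submodule_subgroup iI.2.
have [m /andP[mN Nm]] := nth_root_floor N0 (degree_gt0 Hembed gen).
pose g (f : {ffun 'I_d -> 'I_m.+1}) : K := int_lin t (\row_j (f j : nat)%:Z).
have [f [f' [ff' Iff']]] : exists f f', f != f' /\ I (g f - g f').
  apply: contrapT => H; suff: index_at_least O I (m.+1 ^ d)%N.
    by move=> /(index_at_least_le gI HI); rewrite leqNgt Nm.
  have <- : #|{ffun 'I_d -> 'I_m.+1}| = (m.+1 ^ d)%N by rewrite card_ffun !card_ord.
  apply: (index_at_least_fin (r := g)); split=> [f|f f' Iff']; first exact: int_lin_integral.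
  by apply: contrapT => /eqP ff'; apply: H; exists f, f'.
pose v : 'rV[int]_d := \row_j ((f j : nat)%:Z - (f' j : nat)%:Z).
have pE : g f - g f' = int_lin t v.
  by rewrite -int_linB; congr int_lin; apply/rowP => j; rewrite !mxE.
set p := g f - g f' in Iff' pE.
have p0 : p != 0.
  apply: contraNneq ff' => p0; apply/eqP/ffunP => j; apply/val_inj => /=.
  have /rowP/(_ j) : \row_j (f j : nat)%:Z = \row_j (f' j : nat)%:Z :> 'rV[int]_d.
    by apply: (int_lin_inj Hembed gen); apply/eqP; rewrite -subr_eq0; apply/eqP.
  by rewrite !mxE => -[].
have pk k : cabs (emb k p) <= Z * m%:R.
  rewrite -[k](enum_rankK) -[emb _]/(em (enum_rank k)) pE int_linE rmorph_sum.
  apply: (le_trans (cabs_sum _ _ _)).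
  apply: (@le_trans _ _ (\sum_(j < d) cabs (em (enum_rank k) t ^+ j) * m%:R)).
    apply: ler_sum => j _; rewrite rmorphM rmorph_int rmorphXn cabsM mulrC.
    rewrite ler_wpM2l ?cabs_ge0 // -(rmorph_int (real_complex R)) cabs_real -intr_norm.
    rewrite -[m%:R]/(m%:Z%:~R) ler_int mxE ler_norml.
    by have := ltn_ord (f j); have := ltn_ord (f' j); lia.
  by rewrite -mulr_suml ler_wpM2r.
exists p, m; split=> //; first by rewrite mN Nm.
have gJ : subgroup (scale p^-1 I) by apply: scale_subgroup.
have pV0 : p^-1 != 0 by rewrite invr_eq0.
split=> //.
  by move=> x Ox; rewrite scaleE // invrK; apply: (submoduleM iI.2).
have [n nP nE] := index_principal Hembed (iI.1 _ Iff') p0.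
have pI : scale p O `<=` I by apply: scale_integers_sub => //; case: iI.
(* The norm of [p] is at most [(Z m)^d], with [m^d <= ideal_norm I] and [Z^d < M]. *)
have n_le : (n <= ideal_norm I * M)%N.
  rewrite -(ler_nat R) nE natrM.
  apply: (@le_trans _ _ (Z ^+ d * (m ^ d)%:R)).
    rewrite natrX -exprMn -[X in _ ^+ X]/(#|{: embedding_index r1 r2}|) -prodr_const.
    by apply: ler_prod => k _; rewrite cabs_ge0 pk.
  by rewrite mulrC ler_pM ?ler_nat ?ler0n ?exprn_ge0 // ltW.
move=> _ [x Ix <-]; rewrite scaleE ?invr_eq0 // invrK.
(* If the [M + 1] multiples [0, x, ..., M x] were incongruent modulo [(p)], the index of [(p)] in
   [O] would be at least [ideal_norm I * (M + 1)], against [n_le]. *)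
have [i [j [lt_ij jM Hij]]] : exists i j,
    [/\ (i < j)%N, (j <= M)%N & scale p O (x *+ j - x *+ i)].
  apply: contrapT => H.
  have : index_at_least I (scale p O) M.+1.
    exists (fun i : 'I_M.+1 => x *+ i); split=> [i|i j Hij]; first exact: subgroupMn.
    apply/val_inj; apply: contrapT => /eqP; rewrite neq_ltn => /orP[lt_ij|lt_ji]; apply: H.
      exists i, j; split=> //; first by rewrite -ltnS.
      by apply: subgroup_sub_sym Hij; apply: scale_subgroup.
    by exists j, i; split=> //; rewrite -ltnS.
  move=> /(index_at_least_mul gO gI iI.1 pI (has_index_at_least HI)).
  move=> /(index_at_least_le (scale_subgroup p gO) nP) /leq_trans/(_ n_le).
  by rewrite leq_pmul2l // ltnn.
have : scale p O (x *+ M`!).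
  have /dvdnP[q ->] : (j - i %| M`!)%N.
    by rewrite dvdn_fact // subn_gt0 lt_ij (leq_trans (leq_subr _ _)).
  rewrite mulnC mulrnA mulrnBr; last exact: ltnW.
  by apply: subgroupMn => //; apply: scale_subgroup.
by rewrite scaleE // -[x *+ _]mulr_natr mulrC mulrA.
Qed.

(** Two powers [P^i] and [P^j] are scaled to the same member of [F], whence [w P^i = P^j]. It
    remains to cancel [P^i]: the module [D = w^-1 P^(j-i)] satisfies [D P^i = P^i], so [D] is inside
    [O] by the determinant trick and contains 1 by Nakayama. *)
Lemma power_principal P : is_ideal P -> is_nonzero P ->
  exists h w, [/\ (0 < h)%N, w != 0 & ideal_exp P h = scale w O].
Proof.
move=> iP nP; have [Z [F [_ finF HF]]] := balanced_generators.
have iPn n : is_ideal (ideal_exp P n) by apply: ideal_exp_ideal.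
have nPn n : is_nonzero (ideal_exp P n).
  by case: nP => x Px x0; exists (x ^+ n); [apply: ideal_exp_memX | rewrite expf_neq0].
have /choice[p Hp] : forall n, exists p, p != 0 /\ F (scale p^-1 (ideal_exp P n)).
  by move=> n; have [p [m [? ? ? ? ?]]] := HF _ (iPn n) (nPn n); exists p.
have [i [j [lt_ij ij]]] := finite_pigeonhole finF (fun n => (Hp n).2).
have pi0 := (Hp i).1; have pj0 := (Hp j).1.
exists (j - i)%N, (p j / p i); split; rewrite ?subn_gt0 ?mulf_neq0 ?invr_eq0 //.
set w := p j / p i; have w0 : w != 0 by rewrite mulf_neq0 ?invr_eq0.
have wPi : scale w (ideal_exp P i) = ideal_exp P j.
  by rewrite -scaleM ij scaleVK.
pose D := scale w^-1 (ideal_exp P (j - i)).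
have DPi : ideal_mul D (ideal_exp P i) = ideal_exp P i.
  rewrite ideal_mul_scalel ideal_expD; last by case: iP.
  by rewrite subnK 1?ltnW // -wPi scaleK.
have sD : is_submodule D by apply: scale_submodule; case: (iPn (j - i)%N).
have fgPi := is_ideal_fg (iPn i) (nPn i).
have DO : D `<=` O.
  move=> x Dx; apply: (multiplier_integral fgPi (iPn i).1 (nPn i)) => _ [y Py <-].
  by rewrite -DPi; apply: ideal_mul_mem.
have D1 : D 1 by apply: (nakayama _ fgPi (nPn i)); rewrite ?DPi //; split.
by rewrite -(submodule_eq_integers sD DO D1) /D scaleVK.
Qed.

End IdealNorm.

(** * Powers of a prime ideal *)

Section PrimeIdeal.
Variables (R : realType) (K : fieldExtType rat) (r1 r2 : nat)
  (sigma : 'I_r1 -> {rmorphism K -> R}) (tau : 'I_r2 -> {rmorphism K -> R[i]}).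
Hypothesis Hembed : is_embedding_system sigma tau.
Local Notation O := (ring_of_integers K).
Local Notation abs_norm := (abs_norm sigma tau).

Section Facts.
Variable P : set K.
Hypothesis pP : is_prime_ideal P.

Lemma prime_ideal : is_ideal P. Proof. by case: pP. Qed.
Lemma prime_nonzero : is_nonzero P. Proof. by case: pP. Qed.
Let sP : is_submodule P := prime_ideal.2.
Let gP := submodule_subgroup sP.

Lemma prime_notM a b : O a -> O b -> ~ P a -> ~ P b -> ~ P (a * b).
Proof. by case: pP => _ _ _ H Oa Ob Pa Pb /(H _ _ Oa Ob)[]. Qed.

Lemma prime_notX a n : O a -> ~ P a -> ~ P (a ^+ n).
Proof.
move=> Oa Pa; elim: n => [|n IH]; first by case: pP.
by rewrite exprS; apply: prime_notM => //; apply: integersX.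
Qed.

(** [O / P] is finite, so two powers of [x] agree modulo [P]; primality cancels [x^i] in
    [x^i (1 - x^(j-i))]. *)
Lemma prime_unit x : O x -> ~ P x -> exists2 u, O u & P (1 - u * x).
Proof.
move=> Ox Px; have [HP _] := ideal_index Hembed prime_ideal prime_nonzero.
have [i [j [lt_ij Hij]]] : exists i j, (i < j)%N /\ P (x ^+ i - x ^+ j).
  apply: contrapT => H.
  suff /(index_at_least_le gP HP) : index_at_least O P (ideal_norm P).+1 by rewrite ltnn.
  exists (fun i : 'I__ => x ^+ i); split=> [i|i j Hij]; first exact: integersX.
  apply/val_inj; apply: contrapT => /eqP; rewrite neq_ltn => /orP[lt_ij|lt_ji]; apply: H.
    by exists i, j.
  by exists j, i; split=> //; apply: subgroup_sub_sym.
have Ou : O (x ^+ (j - i).-1) by apply: integersX.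
exists (x ^+ (j - i).-1) => //; apply: contrapT => H.
have O1u : O (1 - x ^+ (j - i).-1 * x) by apply: integersB; [exact: integers1 | exact: integersM].
case: (prime_notM (integersX i Ox) O1u (prime_notX Ox Px) H).
rewrite -exprSr prednK ?subn_gt0 // mulrBr mulr1 -exprD subnKC //; exact: ltnW.
Qed.

Lemma prime_unitX x n : O x -> ~ P x -> exists2 u, O u & ideal_exp P n (1 - u * x).
Proof.
move=> Ox Px; have [u Ou Pu] := prime_unit Ox Px.
elim: n => [|n [v Ov Pv]].
  by exists 0; [exact: integers0 | rewrite mul0r subr0; exact: integers1].
exists (u + v - u * v * x).
  by apply: integersB; [apply: integersD | apply: integersM => //; apply: integersM].
have -> : 1 - (u + v - u * v * x) * x = (1 - u * x) * (1 - v * x) by ring.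
exact: ideal_mul_mem.
Qed.

Lemma prime_maximal (Q : set K) : is_ideal Q -> P `<=` Q -> ~ Q 1 -> Q = P.
Proof.
move=> iQ PQ Q1; apply/seteqP; split=> // x Qx; apply: contrapT => Px.
have [u Ou Pu] := prime_unit (iQ.1 _ Qx) Px; apply: Q1.
rewrite -[1](subrK (u * x)); apply: subgroupD; first exact: submodule_subgroup iQ.2.
  exact: PQ.
by apply: (submoduleM iQ.2).
Qed.

Lemma prime_norm_gt1 : (1 < ideal_norm P)%N.
Proof.
have [HP N0] := ideal_index Hembed prime_ideal prime_nonzero.
rewrite ltn_neqAle N0 andbT; apply/negP => /eqP N1; rewrite -N1 in HP.
have [r _ cov] := HP; have [i Hi] := cov 1 (integers1 K); have [j Hj] := cov 0 (integers0 K).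
case: pP => _ _ + _; apply.
rewrite (_ : 1 = 1 - r i - (0 - r j)); first by apply: gP.2.
by rewrite !ord1; ring.
Qed.

Lemma exp_ideal n : is_ideal (ideal_exp P n).
Proof. exact: ideal_exp_ideal prime_ideal. Qed.

Lemma exp_subgroup n : subgroup (ideal_exp P n).
Proof. exact: submodule_subgroup (exp_ideal n).2. Qed.

Lemma exp_nonzero n : is_nonzero (ideal_exp P n).
Proof.
case: prime_nonzero => x Px x0; exists (x ^+ n); last by rewrite expf_neq0.
exact: ideal_exp_memX.
Qed.

(** Otherwise [P^n] would be contained in [P P^n], and Nakayama would put 1 in [P]. *)
Lemma exp_strict n : exists2 a, ideal_exp P n a & ~ ideal_exp P n.+1 a.
Proof.
apply: contrapT => H; case: pP => _ _ P1 _; apply: P1.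
apply: (nakayama prime_ideal (is_ideal_fg Hembed (exp_ideal n) (exp_nonzero n)) (exp_nonzero n)).
by move=> a Ha; apply: contrapT => nHa; apply: H; exists a.
Qed.

(** Multiplication by an element [a] of [P^n] outside [P^(n+1)] embeds [O / P] into [P^n / P^(n+1)]:
    an invertible multiple of [a] modulo [P^(n+1)] cannot vanish. *)
Lemma index_at_least_exp_succ n :
  index_at_least (ideal_exp P n) (ideal_exp P n.+1) (ideal_norm P).
Proof.
have [[r [Or Pr] _] _] := ideal_index Hembed prime_ideal prime_nonzero.
have [a Ha nHa] := exp_strict n.
exists (fun i => r i * a); split=> [i|i j]; first exact: (submoduleM (exp_ideal n).2).
rewrite -mulrBl => H; apply: Pr; apply: contrapT => nP; apply: nHa.
have Orij : O (r i - r j) by apply: integersB.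
have [u Ou Pu] := prime_unit Orij nP.
rewrite (_ : a = u * ((r i - r j) * a) + (1 - u * (r i - r j)) * a); last by ring.
apply: subgroupD; first exact: exp_subgroup.
  exact: (submoduleM (exp_ideal n.+1).2).
exact: ideal_mul_mem.
Qed.

Lemma index_at_least_exp n : index_at_least O (ideal_exp P n) (ideal_norm P ^ n)%N.
Proof.
elim: n => [|n IH].
  exists (fun=> 0); split=> [_|i j _]; first exact: integers0.
  by rewrite !ord1.
rewrite expnSr; apply: (index_at_least_mul (integers_subgroup K) (exp_subgroup n) _ _ IH).
- by case: (exp_ideal n).
- exact: ideal_exp_sub1 prime_ideal.
- exact: index_at_least_exp_succ.
Qed.

(** With [m] the index of [(a)], membership of [a] in [P^m] would give [ideal_norm P ^ m <= m],
    impossible since the norm of [P] exceeds 1. *)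
Lemma integral_ord_exists a : O a -> a != 0 -> exists n, integral_ord P a n.
Proof.
move=> Oa a0; have [m mP _] := index_principal Hembed Oa a0.
have ex1 : exists n, `[< ~ ideal_exp P n a >].
  exists m; apply/asboolP => Ha.
  have : index_at_least O (scale a O) (ideal_norm P ^ m)%N.
    have [r [Or Hr]] := index_at_least_exp m; exists r; split=> // i j Hij; apply: Hr.
    exact: (scale_integers_sub (exp_ideal m).2 Ha).
  move=> /(index_at_least_le (scale_subgroup a (integers_subgroup K)) mP).
  by rewrite leqNgt ltn_expl // prime_norm_gt1.
case: (ex_minnP ex1) => -[/asboolP[]//|n] /asboolP nH nmin; exists n; split=> //.
apply: contrapT => H; have /nmin : `[< ~ ideal_exp P n a >] by apply/asboolP.
by rewrite ltnn.
Qed.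

Lemma integral_ord_uniq a n m : integral_ord P a n -> integral_ord P a m -> n = m.
Proof.
move=> [Hn nHn] [Hm nHm]; apply/eqP; rewrite eqn_leq; apply/andP; split; rewrite leqNgt;
  apply/negP => lt_nm.
  by apply: nHm; apply: (ideal_exp_leq prime_ideal lt_nm).
by apply: nHn; apply: (ideal_exp_leq prime_ideal lt_nm).
Qed.

Lemma integral_ord_leq a n m : integral_ord P a n -> ideal_exp P m a -> (m <= n)%N.
Proof.
move=> [_ nHn] Hm; rewrite leqNgt; apply/negP => lt_nm; apply: nHn.
exact: (ideal_exp_leq prime_ideal lt_nm).
Qed.

Lemma integral_ord0 a : O a -> ~ P a -> integral_ord P a 0.
Proof. by move=> Oa Pa; split=> //; rewrite ideal_exp1. Qed.

(** * Additivity of the order at [P], from a principal power of [P] *)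

Section Principal.
Variables (h : nat) (w : K).
Hypotheses (h0 : (0 < h)%N) (w0 : w != 0) (Pw : ideal_exp P h = scale w O).

Lemma exp_principalM k m : ideal_exp P (h * k + m) = scale (w ^+ k) (ideal_exp P m).
Proof. exact: ideal_exp_scale. Qed.

Lemma exp_principal k : ideal_exp P (h * k) = scale (w ^+ k) O.
Proof. by rewrite -[(h * k)%N]addn0 exp_principalM. Qed.

Lemma generator_integral : O w.
Proof.
by apply: (exp_ideal h).1; rewrite Pw -[X in scale _ _ X]mulr1; apply: scale_mem; exact: integers1.
Qed.

Lemma generator_norm : (ideal_norm P ^ h)%:R <= abs_norm w.
Proof.
have [n nP <-] := index_principal Hembed generator_integral w0; rewrite ler_nat.
by apply: (index_at_least_le (scale_subgroup w (integers_subgroup K)) nP);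
  rewrite -Pw; apply: index_at_least_exp.
Qed.

Lemma integral_ord_generator : integral_ord P w h.
Proof.
split; first by rewrite Pw -[X in scale _ _ X]mulr1; apply: scale_mem; exact: integers1.
have := exp_principalM 1 1; rewrite muln1 addn1 expr1 => ->.
rewrite ideal_exp1 // scaleE // divff //; by case: pP.
Qed.

(** Stands in for a uniformizer: after multiplication by [u], only a power of [w] and a factor prime
    to [P] are left. Without such a [u], [a P^((h-1)n)] would lie in [P^(hn+1)]; multiplying by
    [P^n] puts [a w^n] in [w^n P^(n+1)], against the order of [a]. *)
Lemma unit_part a n : integral_ord P a n -> exists u a',
  [/\ ideal_exp P (h.-1 * n) u, O a', ~ P a' & a * u = w ^+ n * a'].
Proof.
move=> [Ha nHa]; have wn0 : w ^+ n != 0 by rewrite expf_neq0.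
have hn : (h.-1 * n + n = h * n)%N by rewrite addnC -mulSn prednK.
have [u Hu nau] : exists2 u, ideal_exp P (h.-1 * n) u & ~ ideal_exp P (h * n + 1) (a * u).
  apply: contrapT => H; apply: nHa.
  have : scale (w ^+ n) (ideal_exp P n.+1) (a * w ^+ n).
    rewrite -exp_principalM addnS -addSn -ideal_expD //.
    have /(_ (a * w ^+ n)) : ideal_mul (scale a (ideal_exp P (h.-1 * n))) (ideal_exp P n)
        `<=` ideal_mul (ideal_exp P (h * n).+1) (ideal_exp P n).
      apply: ideal_mulS => // _ [x Px <-]; rewrite -addn1.
      by apply: contrapT => nax; apply: H; exists x.
    apply; rewrite ideal_mul_scalel ideal_expD // hn exp_principal; apply: scale_mem.
    by rewrite -[X in scale _ _ X]mulr1; apply: scale_mem; exact: integers1.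
  by rewrite scaleE // mulfK.
have : ideal_exp P (h * n) (a * u).
  by rewrite -hn addnC -ideal_expD //; apply: ideal_mul_mem.
rewrite exp_principal => -[a' Oa' E]; exists u, a'; split=> // Pa'; apply: nau.
by rewrite exp_principalM ideal_exp1 // -E; apply: scale_mem.
Qed.

(** Multiplied by [u v], the product [a b] becomes [w^(n+k) a' b'] with [a' b'] outside [P]; a
    higher order of [a b] would put [a' b'] in [P]. *)
Lemma integral_ordM a b n k :
  integral_ord P a n -> integral_ord P b k -> integral_ord P (a * b) (n + k).
Proof.
move=> Ha Hb; split.
  by rewrite -ideal_expD //; apply: ideal_mul_mem; [case: Ha | case: Hb].
have [u [a' [Pu Oa' Pa' Ea]]] := unit_part Ha.
have [v [b' [Pv Ob' Pb' Eb]]] := unit_part Hb.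
move=> Hab; have : scale (w ^+ (n + k)) P (a * b * (u * v)).
  rewrite -{1}[P](ideal_exp1 sP) -exp_principalM.
  have -> : (h * (n + k) + 1 = (n + k).+1 + (h.-1 * n + h.-1 * k))%N.
    by rewrite -mulnDr addSn -mulSn prednK // addn1.
  rewrite -ideal_expD //; apply: ideal_mul_mem => //.
  by rewrite -ideal_expD //; apply: ideal_mul_mem.
rewrite mulrACA Ea Eb mulrACA -exprD scaleE ?expf_neq0 //.
rewrite [X in P X]mulrC mulKf ?expf_neq0 //.
exact: prime_notM.
Qed.

End Principal.
End Facts.
End PrimeIdeal.

(** * Valuations and completions *)

(** Used with [P^h = (w)]: it implies [integral_outside P] without mentioning the other primes, and
    is visibly stable under ring operations. *)
Definition integral_away (K : fieldExtType rat) (w x : K) : Prop :=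
  exists k, ring_of_integers K (w ^+ k * x).

Section IntegralAway.
Variables (K : fieldExtType rat) (w : K).
Local Notation O := (ring_of_integers K).
Hypothesis Ow : O w.

Lemma integral_away_integer x : O x -> integral_away w x.
Proof. by move=> Ox; exists 0%N; rewrite expr0 mul1r. Qed.

Lemma integral_awayM x y : integral_away w x -> integral_away w y -> integral_away w (x * y).
Proof.
move=> [k Hk] [l Hl]; exists (k + l)%N; rewrite exprD mulrACA; exact: integersM.
Qed.

Lemma integral_awayB x y : integral_away w x -> integral_away w y -> integral_away w (x - y).
Proof.
move=> [k Hk] [l Hl]; exists (k + l)%N.
rewrite (_ : _ * _ = w ^+ l * (w ^+ k * x) - w ^+ k * (w ^+ l * y)); last by rewrite exprD; ring.
by apply: integersB; apply: integersM => //; apply: integersX.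
Qed.

Lemma integral_awayV k : w != 0 -> integral_away w (w ^+ k)^-1.
Proof. by move=> w0; exists k; rewrite divff ?expf_neq0 //; exact: integers1. Qed.
End IntegralAway.

Section Completion.
Variables (R : realType) (K : fieldExtType rat) (r1 r2 : nat)
  (sigma : 'I_r1 -> {rmorphism K -> R}) (tau : 'I_r2 -> {rmorphism K -> R[i]}).
Hypothesis Hembed : is_embedding_system sigma tau.
Local Notation O := (ring_of_integers K).
Variable P : set K.
Hypothesis pP : is_prime_ideal P.
Variables (h : nat) (w : K).
Hypotheses (h0 : (0 < h)%N) (w0 : w != 0) (Pw : ideal_exp P h = scale w O).
Let sP : is_submodule P := (prime_ideal pP).2.

(** The set given to [xget] is a singleton: from [a b' = a' b], additivity gives
    [n + k' = n' + k]. *)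
Lemma valuation_frac a b n k : O a -> O b -> a != 0 -> b != 0 ->
  integral_ord P a n -> integral_ord P b k -> valuation P (a / b) = (n%:Z - k%:Z)%:E.
Proof.
move=> Oa Ob a0 b0 Ha Hb.
rewrite /valuation mulf_eq0 invr_eq0 (negPf a0) (negPf b0) /=; congr (_%:E).
apply: xget_subset1; first by exists a, b, n, k.
suff H m : [set m | exists (a0 b0 : K) (n0 k0 : nat),
     [/\ O a0 /\ integral_ord P a0 n0, O b0 /\ integral_ord P b0 k0,
      a0 != 0 /\ b0 != 0, a / b = a0 / b0 & m = n0%:Z - k0%:Z]] m -> m = n%:Z - k%:Z.
  by move=> m m' /H -> /H ->.
move=> [a' [b' [n' [k' [[Oa' Ha'] [Ob' Hb'] [a'0 b'0] /eqP]]]]].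
rewrite eqr_div // => /eqP E ->.
have := integral_ordM pP h0 w0 Pw Ha Hb'.
rewrite E => /(integral_ord_uniq pP (integral_ordM pP h0 w0 Pw Ha' Hb)); lia.
Qed.

Lemma valuation_exists x : x != 0 -> exists m : int, valuation P x = m%:E.
Proof.
move=> x0; have [b b0 Oa] := integral_multiple x.
have bK0 : b%:~R != 0 :> K by rewrite -in_alg_int fmorph_eq0 intr_eq0.
have [n Hn] := integral_ord_exists Hembed pP Oa (mulf_neq0 bK0 x0).
have [k Hk] := integral_ord_exists Hembed pP (integers_int K b) bK0.
exists (n%:Z - k%:Z); rewrite -(valuation_frac Oa _ _ bK0 Hn Hk) ?mulf_neq0 //.
  by rewrite mulrC mulKf.
exact: integers_int.
Qed.

Lemma valuation_integral_ord a n : O a -> a != 0 -> integral_ord P a n ->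
  valuation P a = n%:Z%:E.
Proof.
move=> Oa a0 Ha; rewrite -[a in LHS]divr1.
have P1 : ~ P 1 by case: pP.
have O1 := integers1 K.
by rewrite (valuation_frac Oa O1 a0 (oner_neq0 _) Ha (integral_ord0 pP O1 P1)) subr0.
Qed.

Lemma valuation_exp a n : O a -> ideal_exp P n a <-> (n%:Z%:E <= valuation P a)%E.
Proof.
move=> Oa; have [->|a0] := eqVneq a 0.
  rewrite /valuation eqxx leey; split=> // _; exact: submodule0 (exp_ideal pP n).2.
have [m Hm] := integral_ord_exists Hembed pP Oa a0.
rewrite (valuation_integral_ord Oa a0 Hm) lee_fin lez_nat; split.
  exact: (integral_ord_leq pP).
by move=> nm; apply: (ideal_exp_leq (prime_ideal pP) nm); case: Hm.
Qed.

Lemma integral_away_outside x : integral_away w x -> integral_outside P x.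
Proof.
move=> [k Hk] Q pQ QP.
have [->|x0] := eqVneq x 0; first by rewrite /valuation eqxx leey.
have [p Pp Qp] : exists2 p, P p & ~ Q p.
  apply: contrapT => H; apply: QP; apply: (prime_maximal Hembed pP).
  - exact: prime_ideal.
  - by move=> p Pp; apply: contrapT => nQp; apply: H; exists p.
  - by case: pQ.
have Op := (prime_ideal pP).1 _ Pp.
pose p' := p ^+ (h * k).
have Qp' : ~ Q p' by apply: prime_notX.
have Op'x : O (p' * x).
  have : ideal_exp P (h * k) p' by apply: ideal_exp_memX.
  rewrite (exp_principal pP Pw) => -[o Oo <-]; rewrite mulrAC; exact: integersM.
rewrite /valuation (negPf x0) lee_fin; case: xgetP => // m _.
move=> [a [b [n [l [[Oa Ha] [Ob Hb] [a0 b0] xE ->]]]]].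
rewrite subr_ge0 lez_nat; apply: (integral_ord_leq pQ Ha).
have [u Ou Qu] := prime_unitX Hembed pQ l (integersX (h * k) Op) Qp'.
have gQ := exp_subgroup pQ l; have sQ := (exp_ideal pQ l).2.
rewrite (_ : a = u * (b * (p' * x)) + a * (1 - u * p')).
  apply: subgroupD => //; last exact: submoduleM.
  by apply: submoduleM => //; apply: submodule_mulr => //; case: Hb.
rewrite xE; field.
exact: b0.
Qed.

Section Val.
Variable KP : completion P.
Local Notation emb := (completion_embed KP).
Local Notation val := (completion_val KP).

Lemma completion_valE a : val (emb a) = valuation P a.
Proof. exact: completion_val_embed. Qed.

Lemma valuationM x y : valuation P (x * y) = (valuation P x + valuation P y)%E.
Proof. by rewrite -!completion_valE rmorphM completion_valM. Qed.

Lemma completion_val0 : val 0 = +oo%E.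
Proof. exact/completion_val_eqy. Qed.

Lemma completion_val_leD m (x y : KP) :
  (m <= val x)%E -> (m <= val y)%E -> (m <= val (x + y)%R)%E.
Proof.
move=> Hx Hy; apply: le_trans (completion_valD _ _).
by rewrite le_min Hx Hy.
Qed.

Lemma valuationN x : valuation P (- x) = valuation P x.
Proof.
rewrite -mulN1r valuationM; have O1 := integers1 K.
have P1 : ~ P (-1).
  move=> H; case: pP => _ _ + _; apply; rewrite -[1]opprK; apply: subgroupN => //.
  exact: submodule_subgroup.
have ON1 := integersN O1.
by rewrite (valuation_integral_ord ON1 _ (integral_ord0 pP ON1 P1)) ?add0e // oppr_eq0 oner_neq0.
Qed.

Lemma completion_valN (x : KP) : val (- x) = val x.
Proof. by rewrite -mulN1r completion_valM -(rmorph1 emb) -rmorphN completion_valE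
  valuationN -completion_valE rmorph1 -completion_valM mul1r. Qed.

Lemma completion_val_leB m (x y : KP) :
  (m <= val x)%E -> (m <= val y)%E -> (m <= val (x - y)%R)%E.
Proof. by move=> Hx Hy; apply: completion_val_leD; rewrite ?completion_valN. Qed.

(** For the converse, [x] is divided by an element of [P] of valuation exactly 1. *)
Lemma local_idealE (x : KP) : local_ideal x <-> (1%:E <= val x)%E.
Proof.
split=> [[n [a [y [Hay ->]]]]|x1].
  elim/big_ind: _ => [|u v Hu Hv|i _]; first by rewrite completion_val0 leey.
    exact: completion_val_leD.
  have [Pa Oy] := Hay i; rewrite completion_valM -[1%:E]adde0.
  apply: leeD => //; rewrite completion_valE.
  by apply/(valuation_exp 1); [case: pP => -[+ _] _ _ _; apply | rewrite ideal_exp1].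
have [p Hp nHp] := exp_strict Hembed pP 1.
have Pp : P p by rewrite -[P]ideal_exp1.
have Op := (prime_ideal pP).1 _ Pp.
have p0 : p != 0.
  by apply/eqP => p0; apply: nHp; rewrite p0; exact: submodule0 (exp_ideal pP 2).2.
exists 1%N, (fun=> p), (fun=> x / emb p); split; last first.
  by rewrite big_ord1 mulrC divfK // fmorph_eq0.
move=> _; split=> //; rewrite /local_integers /=.
have E : (val (emb p) + val (x / emb p) = val x)%E.
  by rewrite -completion_valM mulrC divfK // fmorph_eq0.
move: x1; rewrite -E completion_valE (valuation_integral_ord Op p0 (conj Hp nHp)).
case: (val (x / emb p)) => [r||] //; rewrite !lee_fin; lia.
Qed.

Lemma local_ideal_subgroup : subgroup (@local_ideal K P KP).
Proof.
split; first by apply/local_idealE; rewrite completion_val0 leey.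
by move=> x y /local_idealE Hx /local_idealE Hy; apply/local_idealE; apply: completion_val_leB.
Qed.

(** When [w^k z] is integral, its valuation is at least [h k], so it lies in [P^(hk) = (w^k)] and
    [w^k] can be divided out. *)
Lemma integral_away_valuation_ge0 z : integral_away w z -> (0%:E <= valuation P z)%E -> O z.
Proof.
move=> [k Hk] Hz.
have : ideal_exp P (h * k) (w ^+ k * z).
  apply/valuation_exp => //; rewrite valuationM -[X in (X <= _)%E]adde0.
  apply: leeD => //; apply/valuation_exp.
    by apply: integersX; apply: (generator_integral pP Pw).
  rewrite (exp_principal pP Pw) -[X in scale _ _ X]mulr1; apply: scale_mem; exact: integers1.
by rewrite (exp_principal pP Pw) scaleE ?expf_neq0 // mulrAC divff ?expf_neq0 // mul1r.
Qed.

Lemma integral_away_valuation q z : integral_away w z ->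
  ((h * q)%N%:Z%:E <= valuation P z)%E -> exists2 z', O z' & z = w ^+ q * z'.
Proof.
move=> Hz Hq; have wq0 : w ^+ q != 0 by rewrite expf_neq0.
exists (z / w ^+ q); last by rewrite mulrC divfK.
apply: integral_away_valuation_ge0; first by apply: integral_awayM => //; apply: integral_awayV.
have Ow := generator_integral pP Pw.
have Vw : valuation P (w ^+ q) = (h * q)%N%:Z%:E.
  apply: valuation_integral_ord => //; first exact: integersX.
  elim: q {Hq wq0} => [|q IH].
    rewrite muln0 expr0; apply: integral_ord0 => //; first exact: integers1.
    by case: pP.
  rewrite mulnS exprS; apply: (integral_ordM pP h0 w0 Pw) => //.
  exact: integral_ord_generator.
have E : (valuation P (w ^+ q) + valuation P (z / w ^+ q) = valuation P z)%E.
  by rewrite -valuationM mulrC divfK.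
move: Hq; rewrite -E Vw.
case: (valuation P (z / w ^+ q)) => [r||] //; rewrite !lee_fin; lia.
Qed.

(** An approximation [x'] in [K] may have denominators prime to [P]. If [b] clears them and
    [b u = w^k b'], the factor [b'] is inverted modulo a high power of [P] by an integer [c], and
    [x'] is replaced by [x' c b'], whose denominator is a power of [w]. *)
Lemma approx_integral_away (x : KP) : exists2 y, integral_away w y & local_ideal (x - emb y).
Proof.
have [x' Hx'] := completion_dense x 1.
suff [y Sy Hy] : exists2 y, integral_away w y & (1%:E <= valuation P (x' - y))%E.
  exists y => //; apply/local_idealE.
  rewrite (_ : x - emb y = (x - emb x') + emb (x' - y)); last by rewrite rmorphB; ring.
  by apply: completion_val_leD => //; rewrite completion_valE.
have Ow := generator_integral pP Pw.
have [->|x0] := eqVneq x' 0.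
  exists 0; first by apply: integral_away_integer; exact: integers0.
  by rewrite subrr /valuation eqxx leey.
have [m Hm] := valuation_exists x0.
have [b b0 Oa] := integral_multiple x'.
have bK0 : b%:~R != 0 :> K by rewrite -in_alg_int fmorph_eq0 intr_eq0.
have Ob := integers_int K b.
have [k Hk] := integral_ord_exists Hembed pP Ob bK0.
have [u [b' [Pu Ob' Pb' E]]] := unit_part pP h0 w0 Pw Hk.
have Ou := (exp_ideal pP (h.-1 * k)).1 _ Pu.
(* The exponent makes the error [x' (1 - c b')] of valuation at least [m + |m| + 1 >= 1]. *)
have [c Oc Hc] := prime_unitX Hembed pP (`|m|%N + 1) Ob' Pb'.
have b'0 : b' != 0.
  by apply: contra_notN Pb' => /eqP ->; exact: submodule0 sP.
have wk0 : w ^+ k != 0 by rewrite expf_neq0.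
exists ((b%:~R * x') * u * c * (w ^+ k)^-1).
  apply: integral_awayM; last exact: integral_awayV.
  by apply: integral_away_integer; do 2 (apply: integersM => //).
rewrite (_ : x' - _ = x' * (1 - c * b')); last first.
  rewrite -[X in x' - X](_ : x' * (b%:~R * u) * c * (w ^+ k)^-1 = _); last by ring.
  by rewrite E mulrBr mulr1; congr (_ - _); field.
have /(valuation_exp _)/= : O (1 - c * b').
  by apply: integersB; [exact: integers1 | exact: integersM].
move=> /(_ (`|m|%N + 1)%N)[/(_ Hc) + _].
rewrite valuationM Hm; case: (valuation _ _) => [r||] //; rewrite !lee_fin; lia.
Qed.

End Val.
End Completion.

(** * The archimedean space *)

Section ComplexContinuity.
Variables (R : realType) (n : nat).
Local Notation V := ('rV[R]_n).

Definition complex_continuous (g : V -> R[i]) :=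
  continuous (fun v => complex.Re (g v) : R) /\ continuous (fun v => complex.Im (g v) : R).

Lemma complex_continuous_cst c : complex_continuous (fun=> c).
Proof. by split; exact: cst_continuous. Qed.

Lemma complex_continuousD f g : complex_continuous f -> complex_continuous g ->
  complex_continuous (fun v => f v + g v).
Proof.
move=> [Rf If] [Rg Ig]; split=> v.
  have -> : (fun v => complex.Re (f v + g v)) =
      (fun v => complex.Re (f v) + complex.Re (g v)).
    by apply/funext => u; case: (f u); case: (g u).
  exact: (continuousD (Rf v) (Rg v)).
have -> : (fun v => complex.Im (f v + g v)) =
    (fun v => complex.Im (f v) + complex.Im (g v)).
  by apply/funext => u; case: (f u); case: (g u).
exact: (continuousD (If v) (Ig v)).
Qed.

Lemma complex_continuousM f g : complex_continuous f -> complex_continuous g ->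
  complex_continuous (fun v => f v * g v).
Proof.
move=> [Rf If] [Rg Ig]; split=> v.
  have -> : (fun v => complex.Re (f v * g v)) =
      (fun v => complex.Re (f v) * complex.Re (g v) - complex.Im (f v) * complex.Im (g v)).
    by apply/funext => u; case: (f u); case: (g u).
  exact: (continuousB (continuousM (Rf v) (Rg v)) (continuousM (If v) (Ig v))).
have -> : (fun v => complex.Im (f v * g v)) =
    (fun v => complex.Re (f v) * complex.Im (g v) + complex.Im (f v) * complex.Re (g v)).
  by apply/funext => u; case: (f u) => a b; case: (g u) => c e /=; rewrite [b * c]mulrC.
exact: (continuousD (continuousM (Rf v) (Ig v)) (continuousM (If v) (Rg v))).
Qed.

Lemma complex_continuous_coord j : complex_continuous (fun v => (v 0 j)%:C%C).
Proof. by split; [exact: coord_continuous | exact: cst_continuous]. Qed.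

Lemma complex_continuous_sum (T : Type) (s : seq T) (F : T -> V -> R[i]) :
  (forall i, complex_continuous (F i)) -> complex_continuous (fun v => \sum_(i <- s) F i v).
Proof.
move=> HF; elim: s => [|i s IH].
  have -> : (fun v => \sum_(i <- [::]) F i v) = fun=> 0 by apply/funext => v; rewrite big_nil.
  exact: complex_continuous_cst.
have -> : (fun v => \sum_(i <- i :: s) F i v) = fun v => F i v + \sum_(i <- s) F i v.
  by apply/funext => v; rewrite big_cons.
exact: complex_continuousD.
Qed.

Lemma complex_continuous_prod (T : Type) (s : seq T) (F : T -> V -> R[i]) :
  (forall i, complex_continuous (F i)) -> complex_continuous (fun v => \prod_(i <- s) F i v).
Proof.
move=> HF; elim: s => [|i s IH].
  have -> : (fun v => \prod_(i <- [::]) F i v) = fun=> 1 by apply/funext => v; rewrite big_nil.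
  exact: complex_continuous_cst.
have -> : (fun v => \prod_(i <- i :: s) F i v) = fun v => F i v * \prod_(i <- s) F i v.
  by apply/funext => v; rewrite big_cons.
exact: complex_continuousM.
Qed.

Lemma complex_continuous_lt (g : V -> R[i]) (c : R) : complex_continuous g ->
  open [set v | cabs (g v) ^+ 2 < c].
Proof.
move=> [Rg Ig].
have cg : continuous (fun v => complex.Re (g v) * complex.Re (g v)
    + complex.Im (g v) * complex.Im (g v) : R).
  by move=> v; exact: (continuousD (continuousM (Rg v) (Rg v)) (continuousM (Ig v) (Ig v))).
have -> : [set v | cabs (g v) ^+ 2 < c] = (fun v => complex.Re (g v) * complex.Re (g v)
    + complex.Im (g v) * complex.Im (g v) : R) @^-1` [set x | x < c].
  by apply/seteqP; split=> v /=; rewrite cabs_sqr !expr2.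
by apply: open_comp; [move=> v _; exact: cg | exact: open_lt].
Qed.

End ComplexContinuity.

(** Except for the product of the [y k], each term of the expansion has a bounded factor [c k],
    hence one power of [m] fewer; the extra [m] avoids the exponent [size s - 1]. In the induction
    [C] is paid twice, for [c k * m * q] and for [(c k + y k) * W], hence [2 * C]. *)
Lemma prod_addr_bound (R : realFieldType) (T : Type) (s : seq T) (c y : T -> R) (C D m : R) :
  0 <= C -> 0 <= D -> 1 <= m -> (forall k, 0 <= c k <= C) -> (forall k, 0 <= y k <= D * m) ->
  m * \prod_(k <- s) (c k + y k) <=
    m * \prod_(k <- s) y k + (2 * C + D) ^+ size s * m ^+ size s.
Proof.
move=> C0 D0 m1 Hc Hy; have m0 : 0 <= m by apply: le_trans m1.
elim: s => [|k s IH]; first by rewrite !big_nil /= !expr0 !mulr1 lerDl ler01.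
rewrite !big_cons /= !exprS.
have /andP[c0 cC] := Hc k; have /andP[y0 yD] := Hy k.
have Y0 : 0 <= \prod_(j <- s) y j by apply: prodr_ge0 => j _; case/andP: (Hy j).
have YD : \prod_(j <- s) y j <= (2 * C + D) ^+ size s * m ^+ size s.
  elim: s {IH Y0} => [|j s IH]; first by rewrite big_nil /= !expr0 mulr1.
  rewrite big_cons /= !exprS mulrACA; have /andP[yj0 yjD] := Hy j.
  apply: ler_pM => //; first by apply: prodr_ge0 => i _; case/andP: (Hy i).
  by apply: le_trans yjD _; rewrite ler_wpM2r // lerDr mulr_ge0 ?ler0n.
set E := 2 * C + D in IH YD *.
set p := \prod_(j <- s) (c j + y j) in IH *; set q := \prod_(j <- s) y j in IH Y0 YD *.
set W := E ^+ size s * m ^+ size s in IH YD *.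
have -> : E * E ^+ size s * (m * m ^+ size s) = E * m * W by rewrite /W mulrACA mulrA.
have W0 : 0 <= W by rewrite mulr_ge0 ?exprn_ge0 // addr_ge0 // mulr_ge0 ?ler0n.
have H1 : (c k + y k) * (m * p) <= (c k + y k) * (m * q + W).
  by rewrite ler_wpM2l // addr_ge0.
have H2 : (c k + y k) * W <= (C * m + D * m) * W.
  by rewrite ler_wpM2r // lerD // (le_trans cC) // ler_peMr.
have H3 : c k * m * q <= C * m * W.
  by apply: ler_pM => //; [rewrite mulr_ge0 | rewrite ler_wpM2r].
rewrite /E; nra.
Qed.

Section ArchimedeanSpace.
Variables (R : realType) (K : fieldExtType rat) (r1 r2 : nat)
  (sigma : 'I_r1 -> {rmorphism K -> R}) (tau : 'I_r2 -> {rmorphism K -> R[i]}).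
Hypothesis Hembed : is_embedding_system sigma tau.
Local Notation O := (ring_of_integers K).
Local Notation inK := (in_alg K).
Local Notation emb := (embedding sigma tau).
Local Notation em := (em sigma tau).
Local Notation d := (degree r1 r2).
Local Notation arch := (arch_space R r1 r2).
Local Notation iota := (arch_embed sigma tau).
Implicit Types (xi : arch) (k : embedding_index r1 r2) (J : set K).

Definition component xi k : R[i] :=
  match k with
  | inl i => (xi.1 i)%:C%C
  | inr (inl j) => xi.2 j
  | inr (inr j) => conjc (xi.2 j)
  end.

Lemma componentM xi eta k : component (xi * eta) k = component xi k * component eta k.
Proof. by case: k => [i0|[j|j]] /=; rewrite ffunE ?rmorphM. Qed.

Lemma componentB xi eta k : component (xi - eta) k = component xi k - component eta k.
Proof. by case: k => [i0|[j|j]] /=; rewrite !ffunE ?rmorphB. Qed.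

Lemma component_embed x k : component (iota x) k = emb k x.
Proof. by case: k => [i0|[j|j]] /=; rewrite ffunE. Qed.

Lemma arch_norm_component xi : `|arch_norm xi| = \prod_k cabs (component xi k).
Proof.
rewrite big_sumType /= big_sumType /= /arch_norm normrM normr_prod; congr (_ * _).
  by apply: eq_bigr => i0 _; rewrite cabs_real.
rewrite normr_prod -big_split; apply: eq_bigr => j _ /=.
rewrite cabsJ -expr2 cabs_sqr; case: (xi.2 j) => a b /=.
by rewrite mulrN opprK -!expr2 ger0_norm // addr_ge0 // sqr_ge0.
Qed.

Definition conj_index k : embedding_index r1 r2 :=
  match k with
  | inl i => inl i
  | inr (inl j) => inr (inr j)
  | inr (inr j) => inr (inl j)
  end.

Lemma embedding_conj k x : emb (conj_index k) x = conjc (emb k x).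
Proof. by case: k => [i0|[j|j]] //=; rewrite ?oppr0 // conjcK. Qed.

Lemma component_conj xi k : component xi (conj_index k) = conjc (component xi k).
Proof. by case: k => [i0|[j|j]] //=; rewrite ?oppr0 // conjcK. Qed.

Section Coordinates.
Variable t : K.
Hypotheses (Ot : O t) (gen : forall x, exists g, x = (map_poly inK g).[t]).

Definition real_combination (v : 'rV[R]_d) : arch :=
  ([ffun i => \sum_l v 0 l * sigma i t ^+ l],
   [ffun j => \sum_l (v 0 l)%:C%C * tau j t ^+ l]).

Lemma component_real_combination v k :
  component (real_combination v) k = \sum_l (v 0 l)%:C%C * emb k t ^+ l.
Proof.
case: k => [i0|[j|j]] /=; rewrite ffunE ?rmorph_sum //=.
  by apply: eq_bigr => l _; rewrite rmorphM rmorphXn.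
by apply: eq_bigr => l _; rewrite rmorphM rmorphXn; congr (_ * _); apply: conjc_real.
Qed.

(* The complex solution of the Vandermonde system is real since conjugation
   permutes its equations. *)
Lemma component_coords xi :
  exists v : 'rV[R]_d, forall k, component xi k = \sum_l (v 0 l)%:C%C * emb k t ^+ l.
Proof.
pose E := power_matrix sigma tau t.
have uE : E \in unitmx by rewrite unitmxE unitfE; apply: det_power_matrix_neq0.
pose y : 'rV[R[i]]_d := \row_k component xi (enum_val k).
have [u uy] : exists u, u *m E = y by exists (y *m invmx E); rewrite mulmxKV.
have uk k : component xi k = \sum_l u 0 l * emb k t ^+ l.
  have /rowP/(_ (enum_rank k)) := uy; rewrite !mxE enum_rankK => <-.
  by apply: eq_bigr => l _; rewrite [E _ _]mxE /em enum_rankK.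
have u_conj : map_mx (@conjc R) u = u.
  rewrite -[LHS](mulmxK uE) -[RHS](mulmxK uE); congr (_ *m _); rewrite uy.
  apply/rowP => k; rewrite !mxE -[RHS]conjcK -component_conj uk rmorph_sum.
  by apply: eq_bigr => l _; rewrite !mxE rmorphM rmorphXn /= embedding_conj conjcK.
exists (map_mx (@complex.Re R) u) => k; rewrite uk; apply: eq_bigr => l _.
congr (_ * _); rewrite mxE; have /rowP/(_ l) := u_conj; rewrite mxE.
by case: (u 0 l) => a b /= [Eb]; have -> : b = 0 by lra.
Qed.

End Coordinates.
End ArchimedeanSpace.

(** * Property (star) with bounded translations *)

Section BoundedStar.
Variables (R : realType) (K : fieldExtType rat) (r1 r2 : nat)
  (sigma : 'I_r1 -> {rmorphism K -> R}) (tau : 'I_r2 -> {rmorphism K -> R[i]}).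
Hypothesis Hembed : is_embedding_system sigma tau.
Local Notation O := (ring_of_integers K).
Local Notation emb := (embedding sigma tau).
Local Notation em := (em sigma tau).
Local Notation d := (degree r1 r2).
Local Notation abs_norm := (abs_norm sigma tau).
Local Notation arch := (arch_space R r1 r2).
Local Notation iota := (arch_embed sigma tau).
Implicit Types (xi : arch) (k : embedding_index r1 r2) (J : set K).

Definition residue xi (x omega : K) k : R[i] := emb k x * component xi k - emb k omega.

Lemma arch_norm_residue xi x omega :
  `|arch_norm (iota x * xi - iota omega)| = \prod_k cabs (residue xi x omega k).
Proof.
rewrite arch_norm_component; apply: eq_bigr => k _.
by rewrite componentB componentM !component_embed.
Qed.

Definition star_bound J (T : set K) (c : R) := forall xi, exists omega x,
  [/\ J omega, T x & \prod_k cabs (residue xi x omega k) < c].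

Lemma star_ideal_scale (A T : set K) delta e : e != 0 ->
  star_ideal sigma tau A T delta ->
  star_bound (scale e A) T (abs_norm e * (delta * (ideal_norm A)%:R)).
Proof.
move=> e0 H xi; have [omega [x [Aw Tx]]] := H (iota e^-1 * xi).
rewrite arch_norm_residue => lt; exists (e * omega), x; split=> //; first exact: scale_mem.
have -> : \prod_k cabs (residue xi x (e * omega) k) =
    abs_norm e * \prod_k cabs (residue (iota e^-1 * xi) x omega k).
  rewrite /abs_norm -big_split; apply: eq_bigr => k _ /=; rewrite -cabsM; congr cabs.
  rewrite /residue componentM component_embed mulrBr -rmorphM; congr (_ - _).
  by rewrite fmorphV mulrCA mulVKf // fmorph_eq0.
by rewrite ltr_pM2l // abs_norm_gt0.
Qed.

(** Each pair [(x, omega)] works on an open set of [xi], and finitely many pairs suffice for the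
    compact cube of coordinates. A general [xi] is moved into the cube by an element of [O], whose
    multiple by [x] is absorbed in [omega] because [J] contains [O]. *)
Lemma bounded_star J T c : is_submodule J -> J 1 -> T `<=` O -> star_bound J T c ->
  exists B : nat, forall xi, exists omega x,
    [/\ J omega, T x, \prod_k cabs (residue xi x omega k) < c &
        forall k, cabs (residue xi x omega k) <= B%:R].
Proof.
move=> sJ J1 TO star; have [t Ot gen] := primitive_integer K.
have OJ : O `<=` J by move=> x Ox; rewrite -[x]mulr1; apply: (submoduleM sJ).
have prod0 xi x omega : 0 <= \prod_k cabs (residue xi x omega k).
  by apply: prodr_ge0 => k _; apply: cabs_ge0.
have c0 : 0 < c.
  by have [omega [x [_ _]]] := star 0; apply: le_lt_trans.
have [Z Z0 HZ] := em_bound sigma tau t.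
pose f (i : K * K) k (v : 'rV[R]_d) : R[i] :=
  emb k i.1 * \sum_l (v 0 l)%:C%C * emb k t ^+ l - emb k i.2.
(* The squared modulus is a polynomial in real and imaginary parts, which makes openness
   immediate. *)
pose U i := [set v | cabs (\prod_k f i k v) ^+ 2 < c ^+ 2].
have UE i v : U i v <-> \prod_k cabs (f i k v) < c.
  rewrite /U /= cabs_prod ltr_pXn2r ?nnegrE //; last exact: ltW.
  by apply: prodr_ge0 => k _; apply: cabs_ge0.
have openU i : open (U i).
  apply: complex_continuous_lt; apply: complex_continuous_prod => k.
  apply: complex_continuousD; last exact: complex_continuous_cst.
  apply: complex_continuousM; first exact: complex_continuous_cst.
  apply: complex_continuous_sum => l; apply: complex_continuousM.
    exact: complex_continuous_coord.
  exact: complex_continuous_cst.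
pose cube := [set v : 'rV[R]_d | forall l, `[0, 1]%classic (v ord0 l)].
have : compact cube.
  apply: (@rV_compact _ _ (fun=> `[0, 1]%classic : set R)) => l.
  exact: segment_compact.
rewrite compact_cover => /(_ _ [set i | T i.1 /\ J i.2] U)[|v _|D' D'sub cov].
- by move=> i _; apply: openU.
- have [omega [x [Jw Tx lt]]] := star (real_combination sigma tau t v).
  exists (x, omega) => //; apply/UE; congr (_ < _): lt; apply: eq_bigr => k _.
  by rewrite /residue component_real_combination.
have [B HB] : exists n : nat, forall i, [set` D'] i ->
    forall v, cube v -> forall k, cabs (f i k v) <= n%:R.
  apply: (finite_set_bound (finite_fset D')).
    by move=> i n m nm H v cv k; apply: le_trans (H v cv k) _; rewrite ler_nat.
  move=> i _; pose S := \sum_k (cabs (emb k i.1) * Z + cabs (emb k i.2)).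
  have S0 : 0 <= S.
    by apply: sumr_ge0 => k _; rewrite addr_ge0 ?mulr_ge0 ?cabs_ge0 // ltW.
  exists (Num.Def.archi_bound S) => v cv k; apply: le_trans (ltW (archi_boundP S0)).
  apply: (@le_trans _ _ (cabs (emb k i.1) * Z + cabs (emb k i.2))); last first.
    rewrite /S (bigD1 k) //= lerDl; apply: sumr_ge0 => j _.
    by rewrite addr_ge0 ?mulr_ge0 ?cabs_ge0 // ltW.
  apply: (le_trans (cabsD _ _)); rewrite cabsN lerD2r cabsM ler_wpM2l ?cabs_ge0 //.
  apply: (le_trans (cabs_sum _ _ _)); apply: le_trans (HZ (enum_rank k)).
  rewrite /em enum_rankK; apply: ler_sum => l _.
  have := cv l; rewrite /= in_itv /= => /andP[v0 v1].
  by rewrite cabsM cabs_real ger0_norm // ler_piMl ?cabs_ge0.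
exists B => xi; have [v Hv] := component_coords Hembed gen xi.
pose fl : 'rV[int]_d := \row_l Num.floor (v 0 l).
pose u : 'rV[R]_d := \row_l (v 0 l - (Num.floor (v 0 l))%:~R).
have cu : cube u.
  move=> l; rewrite /= in_itv /= mxE; have := floor_itv (v 0 l).
  by rewrite intrD => /andP[? ?]; apply/andP; split; lra.
have [[x omega] D'i Ui] := cov u cu.
have [Tx Jw] : T x /\ J omega by have /set_mem[] := D'sub _ D'i.
have E k : residue xi x (omega + x * int_lin t fl) k = f (x, omega) k u.
  rewrite /residue /f /= Hv int_linE rmorphD rmorphM rmorph_sum /= opprD addrCA addrC.
  rewrite -mulrBr -sumrB; congr (_ * _ - _); apply: eq_bigr => l _.
  by rewrite !mxE rmorphM rmorph_int rmorphXn rmorphB /= rmorph_int mulrBl.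
exists (omega + x * int_lin t fl), x; split=> //.
- apply: (submoduleD sJ) => //; apply: OJ; apply: integersM; first exact: TO.
  exact: int_lin_integral.
- by under eq_bigr do rewrite E; apply/UE.
- by move=> k; rewrite E; apply: HB.
Qed.

Lemma class_star (A T : set K) (delta delta' : R) :
  is_ideal A -> is_nonzero A -> star_ideal sigma tau A T delta ->
  T `<=` O -> finite_set T -> delta < delta' ->
  exists N0 : nat, forall P c, is_ideal P -> is_nonzero P -> c != 0 -> P = scale c A ->
    (N0 <= ideal_norm P)%N -> forall y, exists omega x, [/\ P omega, T x &
      \prod_k (cabs (emb k x) + cabs (emb k (x * y - omega))) <= delta' * (ideal_norm P)%:R].
Proof.
move=> iA nA star TO finT dd'.
have [Z [F [Z0 finF HF]]] := balanced_generators Hembed.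
have [t _ gen] := primitive_integer K.
have d0 := degree_gt0 Hembed gen.
have [CT HCT] : exists n : nat, forall x, T x -> forall k, cabs (emb k x) <= n%:R.
  apply: (finite_set_bound finT) => [x n m nm H k|x _].
    by apply: le_trans (H k) _; rewrite ler_nat.
  pose S := \sum_k cabs (emb k x).
  have S0 : 0 <= S by apply: sumr_ge0 => k _; apply: cabs_ge0.
  exists (Num.Def.archi_bound S) => k; apply: le_trans (ltW (archi_boundP S0)).
  by rewrite /S (bigD1 k) //= lerDl; apply: sumr_ge0 => j _; apply: cabs_ge0.
(* The bound must depend on [J] alone, while the same [J] arises from many scalars [e] as [P]
   varies; hence the quantification over [e] inside. *)
pose bounded J (n : nat) := J 1 -> forall e, e != 0 -> J = scale e A ->
  forall xi, exists omega x, [/\ J omega, T x,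
    \prod_k cabs (residue xi x omega k) < abs_norm e * (delta * (ideal_norm A)%:R) &
    forall k, cabs (residue xi x omega k) <= n%:R].
have [B HB] : exists n, forall J, F J -> bounded J n.
  apply: (finite_set_bound finF) => [J n m nm H J1 e e0 Je xi|J _].
    have [omega [x [Jw Tx lt le]]] := H J1 e e0 Je xi; exists omega, x; split=> // k.
    by apply: le_trans (le k) _; rewrite ler_nat.
  have [[J1 [e e0 Je]]|no] := pselect (J 1 /\ exists2 e, e != 0 & J = scale e A); last first.
    by exists 0%N => J1 e e0 Je; case: no; split=> //; exists e.
  have sJ : is_submodule J by rewrite Je; apply: scale_submodule; case: iA.
  have := star_ideal_scale e0 star; rewrite -Je => /(bounded_star sJ J1 TO)[B HB].
  (* The quotient [e' / e] maps [A] onto itself, so it has norm 1. *)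
  exists B => _ e' e'0 Je'; suff -> : abs_norm e' = abs_norm e by [].
  have Ae : scale (e' / e) A = A.
    by rewrite mulrC -scaleM -Je' Je scaleK.
  have ee'0 : e' / e != 0 by rewrite mulf_neq0 ?invr_eq0.
  have := ideal_norm_scale Hembed iA nA ee'0; rewrite Ae => /(_ iA) /eqP.
  have NA0 : (ideal_norm A)%:R != 0 :> R.
    by rewrite pnatr_eq0 -lt0n; case: (ideal_index Hembed iA nA).
  rewrite -{1}[(ideal_norm A)%:R]mul1r (inj_eq (mulIf NA0)) abs_normM abs_normV //.
  move=> /eqP NE; rewrite -[RHS]mul1r NE divfK //.
  exact: lt0r_neq0 (abs_norm_gt0 sigma tau e0).
pose D : R := Z * B%:R; pose E : R := (2 * CT%:R + D) ^+ d.
have D0 : 0 <= D by rewrite mulr_ge0 // ltW.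
have E0 : 0 <= E by rewrite exprn_ge0 // addr_ge0 // mulr_ge0.
have Ed0 : 0 <= E / (delta' - delta) by rewrite divr_ge0 // subr_ge0 ltW.
(* A norm of at least [(m0 + 1)^d] forces [m > m0], hence [E <= m (delta' - delta)], which absorbs
   the error term [E m^d] of [prod_addr_bound]. *)
have := archi_boundP Ed0; set m0 := Num.Def.archi_bound _ => Em0.
exists (m0.+1 ^ d)%N => P c iP nP c0 Pc NP y.
have [p [m [Pp p0 /andP[mP Pm] Zp FP]]] := HF P iP nP.
have m0m : (m0 < m)%N.
  by have := leq_ltn_trans NP Pm; rewrite ltn_exp2r.
have J1 : scale p^-1 P 1 by exists p => //; rewrite mulVf.
have Je : scale p^-1 P = scale (p^-1 * c) A by rewrite Pc scaleM.
have pc0 : p^-1 * c != 0 by rewrite mulf_neq0 ?invr_eq0.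
have [_ [x [[omega Pw <-] Tx lt le]]] := HB _ FP J1 _ pc0 Je (iota (y / p)).
exists omega, x; split=> //.
have resE k : residue (iota (y / p)) x (p^-1 * omega) k = (emb k p)^-1 * emb k (x * y - omega).
  rewrite /residue component_embed -(fmorphV (emb k)) -!(rmorphM (emb k)) -rmorphB.
  by congr (emb k _); rewrite mulrBr; congr (_ - _); rewrite mulrA mulrC.
have yk k : 0 <= cabs (emb k (x * y - omega)) <= D * m%:R.
  rewrite cabs_ge0 /=; have := le k; rewrite resE cabsM cabsV.
  have pk0 : 0 < cabs (emb k p) by rewrite lt_def cabs_ge0 cabs_eq0 fmorph_eq0 p0.
  rewrite mulrC ler_pdivrMr // => /le_trans; apply.
  by rewrite /D mulrC mulrAC ler_wpM2r.
have prod_lt : \prod_k cabs (emb k (x * y - omega)) < delta * (ideal_norm P)%:R.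
  have := lt; under eq_bigr do rewrite resE cabsM cabsV.
  rewrite big_split /= prodfV -/(abs_norm p) abs_normM abs_normV // -mulrA.
  rewrite ltr_pM2l ?invr_gt0 ?abs_norm_gt0 // Pc (ideal_norm_scale Hembed iA nA c0) -?Pc //.
  by rewrite mulrCA.
have ck k : 0 <= cabs (emb k x) <= CT%:R by rewrite cabs_ge0 HCT.
have m1 : 1 <= m%:R :> R by rewrite ler1n; apply: leq_trans m0m.
have mpos : 0 < m%:R :> R by apply: lt_le_trans m1.
have := prod_addr_bound (index_enum (embedding_index r1 r2)) (ler0n R CT) D0 m1 ck yk.
have -> : size (index_enum (embedding_index r1 r2)) = d.
  by rewrite /degree cardT enumT.
rewrite -/E => H.
rewrite -(ler_pM2l mpos); apply: (le_trans H).
have mdN : m%:R ^+ d <= (ideal_norm P)%:R :> R by rewrite -natrX ler_nat.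
have H1 : E * m%:R ^+ d <= E * (ideal_norm P)%:R by rewrite ler_wpM2l.
have H2 : m%:R * \prod_k cabs (emb k (x * y - omega)) <= m%:R * (delta * (ideal_norm P)%:R).
  by rewrite ler_wpM2l // ltW.
have H3 : E <= m%:R * (delta' - delta).
  rewrite -ler_pdivrMr ?subr_gt0 //; apply: (le_trans (ltW Em0)).
  by rewrite ler_nat ltnW.
have H4 : E * (ideal_norm P)%:R <= m%:R * (delta' - delta) * (ideal_norm P)%:R.
  by rewrite ler_wpM2r.
apply: (le_trans (lerD H2 (le_trans H1 H4))).
by rewrite le_eqVlt; apply/orP; left; apply/eqP; ring.
Qed.

End BoundedStar.

(** * Continued fractions *)

Lemma geometric_lt1 (R : realType) (X e : R) : 0 < e -> e < 1 ->
  exists n, X * e ^+ n < 1.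
Proof.
move=> e0 e1; pose r := e^-1 - 1.
have r0 : 0 < r by rewrite subr_gt0 invf_gt1.
have bernoulli n : n%:R * r <= e^-1 ^+ n.
  suff : 1 + n%:R * r <= e^-1 ^+ n by apply: le_trans; rewrite lerDr ler01.
  elim: n => [|n IH]; first by rewrite mul0r addr0 expr0.
  have -> : e^-1 = 1 + r by rewrite /r addrC subrK.
  have := IH; rewrite (_ : e^-1 = 1 + r) ?exprS; last by rewrite /r addrC subrK.
  move=> H; have : (1 + r) * (1 + n%:R * r) <= (1 + r) * (1 + r) ^+ n.
    by rewrite ler_wpM2l // addr_ge0 // ltW.
  apply: le_trans; rewrite -natr1; have := mulr_ge0 (ler0n R n) (sqr_ge0 r).
  by rewrite expr2; nra.
have := archi_boundP (divr_ge0 (normr_ge0 X) (ltW r0)); set n := Num.Def.archi_bound _ => Hn.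
exists n; apply: (@le_lt_trans _ _ (`|X| * e ^+ n)).
  by rewrite ler_wpM2r ?exprn_ge0 ?ler_norm // ltW.
rewrite -[X in _ < X](mulfV (lt0r_neq0 (exprn_gt0 n e0))) mulrC ltr_pM2l ?exprn_gt0 //.
rewrite -exprVn; apply: lt_le_trans (bernoulli n).
by rewrite -ltr_pdivrMr.
Qed.

Lemma finite_ideals_containing (R : realType) (K : fieldExtType rat) (r1 r2 : nat)
    (sigma : 'I_r1 -> {rmorphism K -> R}) (tau : 'I_r2 -> {rmorphism K -> R[i]}) (x : K) :
  is_embedding_system sigma tau -> ring_of_integers K x -> x != 0 ->
  finite_set [set I : set K | is_ideal I /\ I x].
Proof.
move=> Hembed Ox x0; have [n nP _] := index_principal Hembed Ox x0.
apply: sub_finite_set (finite_between (scale_subgroup x (integers_subgroup K)) nP).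
move=> I [[IO sI] Ix]; split=> //; first exact: submodule_subgroup.
exact: scale_integers_sub.
Qed.

Section Expansion.
Variables (R : realType) (K : fieldExtType rat) (r1 r2 : nat)
  (sigma : 'I_r1 -> {rmorphism K -> R}) (tau : 'I_r2 -> {rmorphism K -> R[i]}).
Hypothesis Hembed : is_embedding_system sigma tau.
Local Notation O := (ring_of_integers K).
Local Notation femb := (embedding sigma tau).
Local Notation abs_norm := (abs_norm sigma tau).

(** Two of the integers [0, ..., ideal_norm P] are congruent modulo [P], and their difference
    divides [n!]. Ideals of bounded norm thus share a fixed nonzero element, which leaves finitely
    many. *)
Lemma ideal_norm_fact_mem (P : set K) n : is_ideal P -> is_nonzero P ->
  (ideal_norm P <= n)%N -> P n`!%:R.
Proof.
move=> iP nP Pn; have gP := submodule_subgroup iP.2.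
have [HP _] := ideal_index Hembed iP nP.
have [i [j [lt_ij jn Hij]]] : exists i j : nat,
    [/\ (i < j)%N, (j <= ideal_norm P)%N & P (j%:R - i%:R)].
  apply: contrapT => H.
  suff /(index_at_least_le gP HP) : index_at_least O P (ideal_norm P).+1 by rewrite ltnn.
  exists (fun i : 'I__ => i%:R); split=> [i|i j Hij]; first exact: integers_nat.
  apply/val_inj; apply: contrapT => /eqP; rewrite neq_ltn => /orP[lt_ij|lt_ji]; apply: H.
    by exists i, j; split; rewrite -1?ltnS //; apply: subgroup_sub_sym.
  by exists j, i; split; rewrite -1?ltnS.
have /dvdnP[q ->] : (j - i %| n`!)%N.
  by rewrite dvdn_fact // subn_gt0 lt_ij (leq_trans (leq_subr _ _)) // (leq_trans jn).
rewrite natrM natrB; last exact: ltnW.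
by apply: (submoduleM iP.2) => //; exact: integers_nat.
Qed.

Variables (P T : set K) (e : R).
Hypotheses (pP : is_prime_ideal P) (e0 : 0 < e) (e1 : e < 1).
Hypotheses (TO : T `<=` O) (T0 : forall t, T t -> ~ P t).
Hypothesis star : forall y, exists omega x, [/\ P omega, T x &
  \prod_k (cabs (femb k x) + cabs (femb k (x * y - omega))) <= e * (ideal_norm P)%:R].

Section Floor.
Variables (h : nat) (w : K).
Hypotheses (h0 : (0 < h)%N) (w0 : w != 0) (Pw : ideal_exp P h = scale w O).
Variable KP : completion P.
Local Notation emb := (completion_embed KP).

Definition small_digit (y t : K) := [/\ T t, integral_away w (t * y) &
  \prod_k (cabs (femb k t) + cabs (femb k (t * y))) <= e * (ideal_norm P)%:R].

Definition digit (x : KP) : set K :=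
  [set y | local_ideal (x - emb y) /\ exists t, small_digit y t].

Lemma T_neq0 t : T t -> t != 0.
Proof.
by move=> Tt; apply: contra_notN (T0 Tt) => /eqP ->; apply: submodule0 (prime_ideal pP).2.
Qed.

Lemma digit_exists x : exists y, digit x y.
Proof.
have gL := local_ideal_subgroup Hembed pP h0 w0 Pw KP.
have [y0 Sy0 Ly0] := approx_integral_away Hembed pP h0 w0 Pw x.
have [omega [t [Pomega Tt le]]] := star y0.
have t0 := T_neq0 Tt; have Ot := TO Tt.
have Oomega := (prime_ideal pP).1 _ Pomega.
have ty : t * (y0 - omega / t) = t * y0 - omega by field.
exists (y0 - omega / t); split; last first.
  exists t; split; rewrite ?ty //.
  apply: integral_awayB; first exact: (generator_integral pP Pw).
    by apply: integral_awayM => //; apply: integral_away_integer.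
  exact: integral_away_integer.
rewrite (_ : x - _ = (x - emb y0) + emb (omega / t)); last by rewrite rmorphB; ring.
apply: subgroupD => //; apply/(local_idealE Hembed pP h0 w0 Pw).
rewrite completion_valE.
have Vomega : (1%:E <= valuation P omega)%E.
  apply/(valuation_exp Hembed pP h0 w0 Pw 1) => //; rewrite ideal_exp1 //.
  exact: (prime_ideal pP).2.
(* As [t] is outside [P], its valuation is 0 and [omega / t] keeps the positive valuation of
   [omega]. *)
have := valuationM KP t (omega / t); rewrite mulrC divfK // => E.
move: Vomega; rewrite E.
rewrite (valuation_integral_ord pP h0 w0 Pw Ot t0 (integral_ord0 pP Ot (T0 Tt))).
by rewrite add0e.
Qed.

(** The zero coset is singled out to obtain [s 0 = 0]. Elsewhere [xget] depends only on the set
    [digit x], which is the same for all points of a coset. *)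
Definition digit_floor (x : KP) : K :=
  if `[< local_ideal x >] then 0 else xget 0 (digit x).

Lemma floor_digit x : digit x (digit_floor x).
Proof.
rewrite /digit_floor; case: asboolP => Lx; last first.
  by case: xgetP => [y _ //|no]; have [y /no] := digit_exists x.
split; first by rewrite rmorph0 subr0.
(* The digit 0 obeys the size bound as well: dropping the [omega] terms only decreases the
   product. *)
have [omega [t [_ Tt le]]] := star 0; exists t; split=> //.
  by rewrite mulr0; apply: integral_away_integer; exact: integers0.
apply: le_trans le; apply: ler_prod => k _.
by rewrite addr_ge0 ?cabs_ge0 //= mulr0 rmorph0 cabs0 addr0 lerDl cabs_ge0.
Qed.

Lemma floor_is_floor : is_floor T digit_floor.
Proof.
have gL := local_ideal_subgroup Hembed pP h0 w0 Pw KP.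
split=> [x|x||x y Lxy].
- by case: (floor_digit x).
- have [_ [t [Tt St _]]] := floor_digit x; exists t => //.
  exact: (integral_away_outside Hembed pP Pw).
- by rewrite /digit_floor asboolT //; case: gL.
rewrite /digit_floor; have -> : local_ideal x = local_ideal y.
  apply/propext; split=> L.
    by rewrite -[y](subKr x); apply: gL.2.
  by rewrite -[x](subrK y); apply: subgroupD.
have -> // : digit x = digit y.
apply/seteqP; split=> z [Lz Sz]; split=> //.
  by apply: (subgroup_trans gL _ Lz); apply: subgroup_sub_sym.
exact: (subgroup_trans gL Lxy Lz).
Qed.

(** * Termination, by comparing two growth rates *)

Section Finite.
Variable a0 : K.
Hypothesis never_stops : forall n, partial_quotient digit_floor (emb a0) n <> None.

Fixpoint quotient n : K :=
  if n is n'.+1 then 1 / (quotient n' - digit_floor (emb (quotient n'))) else a0.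
Let a n := digit_floor (emb (quotient n)).

Lemma complete_quotientE n :
  complete_quotient digit_floor (emb a0) n = Some (emb (quotient n)).
Proof.
elim: n => [|n IH] //=; have := @never_stops n.+1; rewrite /partial_quotient /= IH.
case: eqP => // _ _; congr Some.
by rewrite fmorph_div rmorph1 rmorphB.
Qed.

Lemma quotient_neq n : quotient n - a n != 0.
Proof.
have := @never_stops n.+1; rewrite /partial_quotient /= complete_quotientE.
case: eqP => // ne _; rewrite subr_eq0; apply/eqP => E.
by apply: ne; rewrite {1}E.
Qed.

Lemma infinite_expansion_absurd : False.
Proof.
have [b b0 Oba] := integral_multiple a0.
have bK0 : b%:~R != 0 :> K by rewrite -in_alg_int fmorph_eq0 intr_eq0.
have Ow := generator_integral pP Pw.
pose beta n := b%:~R * \prod_(i < n) (quotient i - a i).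
have betaS n : beta n.+1 = beta n * (quotient n - a n).
  by rewrite /beta big_ord_recr /= mulrA.
have beta_neq0 n : beta n != 0.
  by rewrite mulf_neq0 //; apply/prodf_neq0 => i _; apply: quotient_neq.
(* The next quotient is the inverse of the last factor, so [beta n.+1 * quotient n.+1 = beta n]. *)
have betaSS n : beta n.+2 = beta n - a n.+1 * beta n.+1.
  rewrite betaS mulrBr /= betaS; have ne := quotient_neq n.
  by rewrite -/(a n) mul1r mulfK // [in RHS]mulrC.
have /choice[t Ht] : forall n, exists t, small_digit (a n) t.
  by move=> n; have [_ [t Ht]] := floor_digit (emb (quotient n)); exists t.
have Tt n : T (t n) by case: (Ht n).
pose z n := (\prod_(i < n) t i) * beta n.
have zSS n : z n.+2 = t n.+1 * (t n * z n) - (t n.+1 * a n.+1) * z n.+1.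
  by rewrite /z betaSS !big_ord_recr /=; ring.
have z0E : z 0%N = b%:~R by rewrite /z /beta !big_ord0 mul1r mulr1.
have z1E : z 1%N = t 0%N * (b%:~R * a0) - b%:~R * (t 0%N * a 0%N).
  by rewrite /z betaS /beta !big_ord_recr !big_ord0 /=; ring.
have Sz n : integral_away w (z n).
  suff [] : integral_away w (z n) /\ integral_away w (z n.+1) by [].
  elim: n => [|n [IH1 IH2]].
    rewrite z0E z1E; have Sb := integral_away_integer w (integers_int K b).
    split=> //; apply: integral_awayB => //.
      by apply: integral_away_integer; apply: integersM => //; apply: TO.
    by apply: integral_awayM => //; case: (Ht 0%N).
  split=> //; rewrite zSS; apply: integral_awayB => //.
    have St m : integral_away w (t m) by apply: integral_away_integer; apply: TO.
    by apply: integral_awayM => //; apply: integral_awayM.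
  by apply: integral_awayM => //; case: (Ht n.+1).
have Vbeta n : (n%:Z%:E <= valuation P (beta n))%E.
  elim: n => [|n IH].
    rewrite /beta big_ord0 mulr1; have Ob := integers_int K b.
    by apply/(valuation_exp Hembed pP h0 w0 Pw 0).
  rewrite betaS (valuationM KP) intS addrC EFinD; apply: leeD => //.
  rewrite -(completion_valE KP) rmorphB; apply/(local_idealE Hembed pP h0 w0 Pw).
  by case: (floor_digit (emb (quotient n))).
have Vz n : (n%:Z%:E <= valuation P (z n))%E.
  rewrite (valuationM KP) -[X in (X <= _)%E]add0e; apply: leeD => //.
  by apply/(valuation_exp Hembed pP h0 w0 Pw 0); apply: integers_prod => i _; apply: TO.
have z_neq0 n : z n != 0.
  by rewrite mulf_neq0 //; apply/prodf_neq0 => i _; apply: T_neq0.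
have [_ NP0] := ideal_index Hembed (prime_ideal pP) (prime_nonzero pP).
set N : R := (ideal_norm P)%:R; have N0 : 0 < N by rewrite ltr0n.
have lower q : N ^+ (h * q) <= abs_norm (z (h * q)%N).
  have [z' Oz' E] := integral_away_valuation Hembed pP h0 w0 Pw KP (Sz _) (Vz (h * q)%N).
  have z'0 : z' != 0 by apply: contraNneq (z_neq0 (h * q)%N) => z'0; rewrite E z'0 mulr0.
  rewrite E abs_normM abs_normX -[X in X <= _]mulr1.
  have [t' _ gen] := primitive_integer K.
  apply: ler_pM => //; [exact: exprn_ge0 (ltW N0) | | exact: (integral_norm_ge1 Hembed gen)].
  rewrite exprM lerXn2r ?nnegrE ?exprn_ge0 ?abs_norm_ge0 //.
  by rewrite -natrX; apply: (generator_norm Hembed pP w0 Pw).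
pose g n k := cabs (femb k (t n)) + cabs (femb k (t n * a n)).
have g_ge0 n k : 0 <= g n k by rewrite addr_ge0 ?cabs_ge0.
pose G0 k := cabs (femb k (t 0%N * z 0%N)) + cabs (femb k (z 1%N)).
have G0_ge0 k : 0 <= G0 k by rewrite addr_ge0 ?cabs_ge0.
(* A common bound for [t n * z n] and [z n.+1] turns the two-term recurrence into multiplication by
   the single factor [g n.+1 k], the one whose product over [k] is at most [e N]. *)
have step n k : cabs (femb k (t n * z n)) <= G0 k * \prod_(i < n) g i.+1 k /\
    cabs (femb k (z n.+1)) <= G0 k * \prod_(i < n) g i.+1 k.
  elim: n => [|n [IH1 IH2]].
    by rewrite big_ord0 mulr1 lerDl lerDr !cabs_ge0.
  have Gn0 : 0 <= G0 k * \prod_(i < n) g i.+1 k.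
    by rewrite mulr_ge0 // prodr_ge0.
  rewrite big_ord_recr /= mulrA [X in _ <= X /\ _]mulrC [X in _ /\ _ <= X]mulrC; split.
    rewrite rmorphM cabsM; apply: ler_pM => //; rewrite ?cabs_ge0 //.
    by rewrite lerDl cabs_ge0.
  rewrite zSS rmorphB; apply: (le_trans (cabsD _ _)); rewrite cabsN mulrDl.
  by apply: lerD; rewrite rmorphM cabsM ler_wpM2l ?cabs_ge0.
pose X : R := \prod_k G0 k.
have X0 : 0 <= X by apply: prodr_ge0.
have upper n : abs_norm (z n.+1) <= X * (e * N) ^+ n.
  apply: (@le_trans _ _ (\prod_k (G0 k * \prod_(i < n) g i.+1 k))).
    by apply: ler_prod => k _; rewrite cabs_ge0; case: (step n k).
  rewrite big_split /= exchange_big /= ler_wpM2l //.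
  rewrite -[n in X in _ <= X]card_ord -prodr_const; apply: ler_prod => i _.
  by rewrite prodr_ge0 //=; case: (Ht i.+1).
(* With [m + 1 = h (n + 1)] the two bounds give [N^(m+1) <= X (e N)^m], that is [N <= X e^m]; as
   [m >= n], the right side is below 1. *)
have [n Xn] := geometric_lt1 X e0 e1.
have hn : (n < h * n.+1)%N by rewrite (leq_trans (ltnSn n)) // leq_pmull.
have hnS : (h * n.+1 = (h * n.+1).-1.+1)%N by rewrite prednK // (leq_ltn_trans _ hn).
have := le_trans (lower n.+1) _; set m := (h * n.+1).-1 in hnS; rewrite hnS.
move=> /(_ _ (upper m)); rewrite exprS exprMn mulrA ler_pM2r ?exprn_gt0 //.
apply/negP; rewrite -ltNge; apply: (@lt_le_trans _ _ 1); last first.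
  by rewrite ler1n.
apply: le_lt_trans Xn; rewrite ler_wpM2l //.
by apply: ler_wiXn2l; [exact: ltW | exact: ltW | rewrite -ltnS -hnS].
Qed.

End Finite.
End Floor.

Lemma prime_CFF : CFF_property P T.
Proof.
move=> KP; have [h [w [h0 w0 Pw]]] := power_principal Hembed (prime_ideal pP) (prime_nonzero pP).
exists (@digit_floor w KP); first exact: (floor_is_floor h0 w0 Pw).
move=> a; apply: contrapT => H; apply: (@infinite_expansion_absurd h w h0 w0 Pw KP a) => n Hn.
by apply: H; exists n.
Qed.

End Expansion.

Theorem theorem5p4 (R : realType) (K : fieldExtType rat) (r1 r2 : nat)
    (sigma : 'I_r1 -> {rmorphism K -> R})
    (tau : 'I_r2 -> {rmorphism K -> R[i]})
    (Hembed : is_embedding_system sigma tau)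
    (T : set K) (T_finite : finite_set T)
    (T_sub : T `<=` (ring_of_integers K `\ 0))
    (C : set (set K)) (HC : is_ideal_class C)
    (delta : R) (delta_gt0 : 0 < delta) (delta_lt1 : delta < 1)
    (Hstar : star_class sigma tau C T delta) :
  finite_set [set P : set K | [/\ is_prime_ideal P, C P & ~ CFF_property P T]].
Proof.
have [I [sI [u Iu u0] _] CE] := HC; have [A [CA iA star]] := Hstar.
have TO : T `<=` ring_of_integers K by move=> t /T_sub[].
have [c c0 AE] : exists2 c, c != 0 & A = scale c I.
  by move: CA; rewrite CE => -[c c0 AE]; exists c.
have nA : is_nonzero A.
  by exists (c * u); [rewrite AE; apply: scale_mem | rewrite mulf_neq0].
pose e := (delta + 1) / 2.
have delta_e : delta < e by rewrite /e; lra.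
have e0 : 0 < e by apply: lt_trans delta_e.
have e1 : e < 1 by rewrite /e; lra.
have [N0 HN] := class_star Hembed iA nA star TO T_finite delta_e.
(* The exceptional primes: the first set catches every norm below [N0], the second every prime at
   which some denominator in [T] is not a unit. *)
pose S := [set P : set K | is_ideal P /\ P N0`!%:R] `|`
  \bigcup_(t in T) [set P : set K | is_ideal P /\ P t].
apply: (@sub_finite_set _ _ S); last first.
  rewrite finite_setU; split.
    apply: (finite_ideals_containing Hembed); first exact: integers_nat.
    by rewrite -(rmorph_nat (in_alg K)) fmorph_eq0 pnatr_eq0 -lt0n fact_gt0.
  apply: bigcup_finite => // t /T_sub[Ot /eqP t0].
  exact: (finite_ideals_containing Hembed).
move=> P [pP CP nCFF]; apply: contrapT => nS; apply: nCFF.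
have iP := prime_ideal pP; have nP := prime_nonzero pP.
have [b b0 PE] : exists2 b, b != 0 & P = scale b I.
  by move: CP; rewrite CE => -[b b0 PE]; exists b.
apply: (prime_CFF Hembed pP e0 e1 TO).
  by move=> t Tt Pt; apply: nS; right; exists t.
apply: (HN P (b / c)) => //; first by rewrite mulf_neq0 ?invr_eq0.
  by rewrite PE AE scaleM divfK.
rewrite leqNgt; apply/negP => lt_N; apply: nS; left; split=> //.
exact: (ideal_norm_fact_mem Hembed iP nP (ltnW lt_N)).
Qed.
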